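(* If $E$ and $F$ are graphs and $E \sim_M F$, then for any field $K$ it is the case that $L_K(E)$ is Morita equivalent to $L_K(F)$. Moreover, in this case there exists a finite sequence of graphs $E_0, E_1, \ldots, E_n$ with $E_0 = E$ and $E_n = F$, and there exist subsets of vertices $V_i \subseteq E_i^0$ and $W_i \subseteq E_{i+1}^0$ for each $0 \leq i \leq n-1$ such that (a) $V_i L_K(E_i) V_i$ is a full corner of $L_K(E_i)$ for $0 \leq i \leq n-1$, (b) $W_i L_K(E_{i+1}) W_i$ is a full corner of $L_K(E_{i+1})$ for $0 \leq i \leq n-1$, and (c) $V_i L_K(E_i) V_i \cong W_i L_K(E_{i+1}) W_i$ for $0 \leq i \leq n-1$.
   Context: Graphs. A graph $E=(E^0,E^1,r,s)$ consists of a countable (finite or countably infinite) set $E^0$ of vertices, a countable set $E^1$ of edges, and maps $r,s:E^1\to E^0$ (range and source). A vertex $v$ is a sink if $s^{-1}(v)=\emptyset$, a source if $r^{-1}(v)=\emptyset$, and regular if $0<|s^{-1}(v)|<\infty$; $E^0_{\mathrm{reg}}$ is the set of regular vertices. Finite paths $\alpha=e_1\cdots e_n$ satisfy $r(e_i)=s(e_{i+1})$, with $s(\alpha)=s(e_1)$, $r(\alpha)=r(e_n)$; vertices are paths of length $0$; $E^*$ is the set of finite paths. Leavitt path algebra and corners. For a field $K$, $L_K(E)$ is the free associative $K$-algebra generated by pairwise orthogonal idempotents $\{v:v\in E^0\}$ and elements $\{e,e^*:e\in E^1\}$, modulo the relations $s(e)e=er(e)=e$, $r(e)e^*=e^*s(e)=e^*$,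 $e^*f=\delta_{e,f}r(e)$, and $v=\sum_{s(e)=v}ee^*$ for $v\in E^0_{\mathrm{reg}}$. It is a ring with local units; Morita equivalence is understood in the standard sense for such rings. For $V\subseteq E^0$, the saturation is $\Sigma(V)=\bigcup_{n\ge0}\Sigma_n(V)$, where $\Sigma_0(V)=\{v\in E^0:\text{there is }\alpha\in E^*\text{ with }s(\alpha)\in V,\ r(\alpha)=v\}$ and $\Sigma_{n+1}(V)=\Sigma_n(V)\cup\{v\in E^0_{\mathrm{reg}}:r(s^{-1}(v))\subseteq\Sigma_n(V)\}$. The corner determined by $V$ is $VL_K(E)V:=\sum_{v,w\in V}vL_K(E)w$; it is called full if $\Sigma(V)=E^0$. Moves. (S): if $w$ is a source that is a regular vertex, delete $w$ and all edges in $s^{-1}(w)$. (O): if $w$ is not a sink and $s^{-1}(w)=\mathcal E_1\sqcup\cdots\sqcup\mathcal E_n$ is a partition into finitely many nonempty sets, at most one of them infinite, form the graph with vertices $\{v^1:v\ne w\}\cup\{w^1,\dots,w^n\}$, edges $\{e^1:r(e)\ne w\}\cup\{e^1,\dots,e^n:r(e)=w\}$, where the range of $e^i$ is $r(e)^1$ if $r(e)\ne w$ and $w^i$ if $r(e)=w$, and the source of $e^i$ is $s(e)^1$ if $s(e)\neq w$ and $w^j$ if $s(e)=w$, $e\in\mathcal E_j$. (I): if $w$ is a regular vertex that is not a source and $r^{-1}(w)=\mathcal E_1\sqcup\cdots\sqcup\mathcal E_n$ is a partition into finitely many nonempty sets, form the graph with vertices $\{v^1:v\ne w\}\cup\{w^1,\dots,w^n\}$,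 edges $\{e^1:s(e)\ne w\}\cup\{e^1,\dots,e^n:s(e)=w\}$, where the range of $e^i$ is $r(e)^1$ if $r(e)\ne w$ and $w^j$ if $r(e)=w$, $e\in\mathcal E_j$, and the source of $e^i$ is $s(e)^1$ if $s(e)\ne w$ and $w^i$ if $s(e)=w$. (R): if $w$ is a regular vertex with $s(r^{-1}(w))=\{x\}$, $s^{-1}(w)=\{f\}$ and $r(f)\ne w$, delete $w$, $f$ and all edges in $r^{-1}(w)$, and for each $e\in r^{-1}(w)$ add an edge $e_f$ from $x$ to $r(f)$. $E\sim_M F$ (move equivalent) means there is a finite sequence of graphs (up to isomorphism) $E=E_0,E_1,\dots,E_n=F$ such that for each $0\le i\le n-1$ one of $E_i,E_{i+1}$ is obtained from the other by one of the moves (S), (O), (I), (R). *)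

(* Defs.v *)
From HB Require Import structures.
From mathcomp Require Import all_boot all_order all_algebra generic_quotient.
From mathcomp Require Import boolp classical_sets functions cardinality.

Set Implicit Arguments.
Unset Strict Implicit.
Unset Printing Implicit Defensive.

Import GRing.Theory.
Local Open Scope classical_set_scope.
Local Open Scope quotient_scope.
Local Open Scope ring_scope.

(** * Rings and algebras without unit *)

(* The product of a ring without unit is the operation [( _ * _ )%g] of the
   multiplicative structure [semigroupType]; [*%R] is reserved by the library
   for rings with a unit. *)
HB.mixin Record isNonunitalRing R of GRing.Zmodule R & Semigroup R := {
  numulDl : forall x y z : R, ((x + y) * z)%g = (x * z)%g + (y * z)%g;
  numulDr : forall x y z : R, (x * (y + z))%g = (x * y)%g + (x * z)%g
}.

#[short(type="nuRingType")]
HB.structure Definition NonunitalRing :=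
  { R of isNonunitalRing R & GRing.Zmodule R & Semigroup R }.

HB.mixin Record isNonunitalAlgebra (K : fieldType) A
    of NonunitalRing A & GRing.Lmodule K A := {
  nuscaleAl : forall (k : K) (x y : A), k *: (x * y)%g = ((k *: x) * y)%g;
  nuscaleAr : forall (k : K) (x y : A), k *: (x * y)%g = (x * (k *: y))%g
}.

#[short(type="nuAlgType")]
HB.structure Definition NonunitalAlgebra (K : fieldType) :=
  { A of isNonunitalAlgebra K A & NonunitalRing A & GRing.Lmodule K A }.

(* Isomorphism of K-algebras between two subalgebras, given by their carrier
   sets: the values of [f] outside [S] play no role. *)
Definition subalg_iso (K : fieldType) (A B : nuAlgType K)
    (S : set A) (T : set B) : Prop :=
  exists f : A -> B,
    [/\ set_bij S T f,
        forall x y, S x -> S y -> f (x + y) = f x + f y,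
        forall x y, S x -> S y -> f (x * y)%g = (f x * f y)%g
      & forall (k : K) x, S x -> f (k *: x) = k *: f x].

(** * Algebras given by generators and relations *)

Section Presentation.
Variables (K : fieldType) (X : Type).

Inductive aterm : Type :=
| Gen of X
| Zero
| Add of aterm & aterm
| Mul of aterm & aterm
| Scale of K & aterm.

HB.instance Definition _ := gen_eqMixin aterm.
HB.instance Definition _ := gen_choiceMixin aterm.

Variable rel : aterm -> aterm -> Prop.

(* The least congruence that contains [rel] and makes the terms an associative,
   not necessarily unital, K-algebra; the opposite of x is (-1) x. *)
Inductive acong : aterm -> aterm -> Prop :=
| ac_rel x y : rel x y -> acong x y
| ac_refl x : acong x x
| ac_sym x y : acong x y -> acong y x
| ac_trans x y z : acong x y -> acong y z -> acong x z
| ac_add x x' y y' : acong x x' -> acong y y' -> acong (Add x y) (Add x' y')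
| ac_mul x x' y y' : acong x x' -> acong y y' -> acong (Mul x y) (Mul x' y')
| ac_scale k x x' : acong x x' -> acong (Scale k x) (Scale k x')
| ac_addA x y z : acong (Add x (Add y z)) (Add (Add x y) z)
| ac_addC x y : acong (Add x y) (Add y x)
| ac_add0 x : acong (Add Zero x) x
| ac_addN x : acong (Add (Scale (-1) x) x) Zero
| ac_scaleA k l x : acong (Scale k (Scale l x)) (Scale (k * l) x)
| ac_scale1 x : acong (Scale 1 x) x
| ac_scaleDr k x y :
    acong (Scale k (Add x y)) (Add (Scale k x) (Scale k y))
| ac_scaleDl k l x :
    acong (Scale (k + l) x) (Add (Scale k x) (Scale l x))
| ac_mulA x y z : acong (Mul x (Mul y z)) (Mul (Mul x y) z)
| ac_mulDl x y z : acong (Mul (Add x y) z) (Add (Mul x z) (Mul y z))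
| ac_mulDr x y z : acong (Mul x (Add y z)) (Add (Mul x y) (Mul x z))
| ac_scaleAl k x y : acong (Scale k (Mul x y)) (Mul (Scale k x) y)
| ac_scaleAr k x y : acong (Scale k (Mul x y)) (Mul x (Scale k y)).

Definition acongb : simpl_rel aterm := [rel x y | `[< acong x y >]].

Lemma acongb_equiv : equiv_class_of acongb.
Proof.
split=> [x|x y|y x z] /=.
- exact/asboolP/ac_refl.
- by apply/asboolP/asboolP; apply: ac_sym.
- by move=> /asboolP xy /asboolP yz; apply/asboolP; apply: ac_trans xy yz.
Qed.

Canonical acongb_equiv_rel := EquivRelPack acongb_equiv.

Definition presalg : Type := {eq_quot acongb_equiv_rel}.

HB.instance Definition _ := Choice.on presalg.

Definition presalg_of (t : aterm) : presalg := \pi_{eq_quot acongb_equiv_rel} t.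

Lemma presalg_eqP x y : presalg_of x = presalg_of y <-> acong x y.
Proof.
split=> [/eqP|xy].
- by rewrite (@eqmodE _ acongb_equiv_rel) => /asboolP.
- by apply/eqP; rewrite (@eqmodE _ acongb_equiv_rel); apply/asboolP.
Qed.

Definition presalg_repr (x : presalg) : aterm :=
  @repr _ {eq_quot acongb_equiv_rel} x.

Lemma presalg_reprK x : presalg_of (presalg_repr x) = x.
Proof. exact: reprK. Qed.

Lemma presalg_repr_of t : acong (presalg_repr (presalg_of t)) t.
Proof. by apply/presalg_eqP; rewrite presalg_reprK. Qed.

Lemma presalgW (P : presalg -> Prop) :
  (forall t, P (presalg_of t)) -> forall x, P x.
Proof. by move=> PP x; rewrite -(presalg_reprK x). Qed.

Definition pa_add x y := presalg_of (Add (presalg_repr x) (presalg_repr y)).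
Definition pa_mul x y := presalg_of (Mul (presalg_repr x) (presalg_repr y)).
Definition pa_scale k x := presalg_of (Scale k (presalg_repr x)).

Lemma pa_addE x y : pa_add (presalg_of x) (presalg_of y) = presalg_of (Add x y).
Proof. by apply/presalg_eqP; apply: ac_add; apply: presalg_repr_of. Qed.

Lemma pa_mulE x y : pa_mul (presalg_of x) (presalg_of y) = presalg_of (Mul x y).
Proof. by apply/presalg_eqP; apply: ac_mul; apply: presalg_repr_of. Qed.

Lemma pa_scaleE k x : pa_scale k (presalg_of x) = presalg_of (Scale k x).
Proof. by apply/presalg_eqP; apply: ac_scale; apply: presalg_repr_of. Qed.

Let paE := (pa_addE, pa_mulE, pa_scaleE).

Fact pa_addA : associative pa_add.
Proof.
elim/presalgW=> x; elim/presalgW=> y; elim/presalgW=> z.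
by rewrite !paE; apply/presalg_eqP/ac_addA.
Qed.

Fact pa_addC : commutative pa_add.
Proof.
elim/presalgW=> x; elim/presalgW=> y.
by rewrite !paE; apply/presalg_eqP/ac_addC.
Qed.

Fact pa_add0 : left_id (presalg_of Zero) pa_add.
Proof. by elim/presalgW=> x; rewrite !paE; apply/presalg_eqP/ac_add0. Qed.

Fact pa_addN : left_inverse (presalg_of Zero) (pa_scale (-1)) pa_add.
Proof. by elim/presalgW=> x; rewrite !paE; apply/presalg_eqP/ac_addN. Qed.

HB.instance Definition _ :=
  GRing.isZmodule.Build presalg pa_addA pa_addC pa_add0 pa_addN.

Fact pa_scaleA k l x : pa_scale k (pa_scale l x) = pa_scale (k * l) x.
Proof.
by elim/presalgW: x => x; rewrite !paE; apply/presalg_eqP/ac_scaleA.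
Qed.

Fact pa_scale1 : left_id 1 pa_scale.
Proof. by elim/presalgW=> x; rewrite !paE; apply/presalg_eqP/ac_scale1. Qed.

Fact pa_scaleDr : right_distributive pa_scale +%R.
Proof.
move=> k; elim/presalgW=> x; elim/presalgW=> y.
by rewrite /GRing.add /= !paE; apply/presalg_eqP/ac_scaleDr.
Qed.

Fact pa_scaleDl x : {morph pa_scale^~ x : k l / k + l}.
Proof.
move=> k l; elim/presalgW: x => x.
by rewrite [RHS]/GRing.add /= !paE; apply/presalg_eqP/ac_scaleDl.
Qed.

HB.instance Definition _ :=
  GRing.Zmodule_isLmodule.Build K presalg
    pa_scaleA pa_scale1 pa_scaleDr pa_scaleDl.

Fact pa_mulA : associative pa_mul.
Proof.
elim/presalgW=> x; elim/presalgW=> y; elim/presalgW=> z.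
by rewrite !paE; apply/presalg_eqP/ac_mulA.
Qed.

HB.instance Definition _ := isSemigroup.Build presalg pa_mulA.

Fact pa_mulDl (x y z : presalg) :
  ((x + y) * z)%g = (x * z)%g + (y * z)%g.
Proof.
elim/presalgW: x => x; elim/presalgW: y => y; elim/presalgW: z => z.
by rewrite /GRing.add /monoid.mul /= !paE; apply/presalg_eqP/ac_mulDl.
Qed.

Fact pa_mulDr (x y z : presalg) :
  (x * (y + z))%g = (x * y)%g + (x * z)%g.
Proof.
elim/presalgW: x => x; elim/presalgW: y => y; elim/presalgW: z => z.
by rewrite /GRing.add /monoid.mul /= !paE; apply/presalg_eqP/ac_mulDr.
Qed.

HB.instance Definition _ := isNonunitalRing.Build presalg pa_mulDl pa_mulDr.

Fact pa_scaleAl (k : K) (x y : presalg) : k *: (x * y)%g = ((k *: x) * y)%g.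
Proof.
elim/presalgW: x => x; elim/presalgW: y => y.
by rewrite /GRing.scale /monoid.mul /= !paE; apply/presalg_eqP/ac_scaleAl.
Qed.

Fact pa_scaleAr (k : K) (x y : presalg) : k *: (x * y)%g = (x * (k *: y))%g.
Proof.
elim/presalgW: x => x; elim/presalgW: y => y.
by rewrite /GRing.scale /monoid.mul /= !paE; apply/presalg_eqP/ac_scaleAr.
Qed.

HB.instance Definition _ :=
  isNonunitalAlgebra.Build K presalg pa_scaleAl pa_scaleAr.

Section UniversalProperty.
Variables (A : nuAlgType K) (g : X -> A).

Fixpoint aeval (t : aterm) : A :=
  match t with
  | Gen x => g x
  | Zero => 0
  | Add t u => aeval t + aeval u
  | Mul t u => (aeval t * aeval u)%g
  | Scale k t => k *: aeval t
  end.

Hypothesis g_rel : forall t u, rel t u -> aeval t = aeval u.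

Lemma aeval_acong t u : acong t u -> aeval t = aeval u.
Proof.
elim=> //=.
- by move=> x y z _ -> _ ->.
- by move=> x x' y y' _ -> _ ->.
- by move=> x x' y y' _ -> _ ->.
- by move=> k x x' _ ->.
- by move=> x y z; rewrite addrA.
- by move=> x y; rewrite addrC.
- by move=> x; rewrite add0r.
- by move=> x; rewrite scaleN1r addNr.
- by move=> k l x; rewrite scalerA.
- by move=> x; rewrite scale1r.
- by move=> k x y; rewrite scalerDr.
- by move=> k l x; rewrite scalerDl.
- by move=> x y z; rewrite mulgA.
- by move=> x y z; rewrite numulDl.
- by move=> x y z; rewrite numulDr.
- by move=> k x y; rewrite nuscaleAl.
- by move=> k x y; rewrite nuscaleAr.
Qed.

Definition nualg_morphism (f : presalg -> A) : Prop :=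
  [/\ {morph f : x y / x + y}, {morph f : x y / (x * y)%g}
    & forall k : K, {morph f : x / k *: x}].

Lemma presalg_universal :
  exists! f : presalg -> A,
    nualg_morphism f /\ forall x, f (presalg_of (Gen x)) = g x.
Proof.
have evalE t : aeval (presalg_repr (presalg_of t)) = aeval t.
  by apply: aeval_acong; apply: presalg_repr_of.
exists (fun x => aeval (presalg_repr x)); split.
  split=> [|x]; last by rewrite evalE.
  split=> [||k]; elim/presalgW=> x; try elim/presalgW=> y;
    by rewrite /GRing.add /GRing.scale /monoid.mul /= !paE !evalE.
move=> f [[fD fM fZ] fg]; apply/funext; elim/presalgW=> t; rewrite evalE.
elim: t => [x||t IHt u IHu|t IHt u IHu|k t IHt] /=; rewrite ?IHt ?IHu.
- by rewrite fg.
- have /eqP := fD 0 0; rewrite addr0 -subr_eq subrr eq_sym => /eqP.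
  by rewrite /GRing.zero /=.
- by rewrite -fD /GRing.add /= paE.
- by rewrite -fM /monoid.mul /= paE.
- by rewrite -fZ /GRing.scale /= paE.
Qed.

End UniversalProperty.

End Presentation.

Arguments Gen {K X}.
Arguments Zero {K X}.

(** * Graphs *)

Record graph : Type := Graph {
  vertex : countType;
  edge : countType;
  src : edge -> vertex;
  rng : edge -> vertex
}.

Section Graphs.
Variable E : graph.
Implicit Types (v w : vertex E) (V : set (vertex E)).

Definition out_edges v : set (edge E) := [set e | src e = v].
Definition in_edges v : set (edge E) := [set e | rng e = v].

Definition is_sink v : Prop := out_edges v = set0.
Definition is_source v : Prop := in_edges v = set0.
Definition regular v : Prop := out_edges v !=set0 /\ finite_set (out_edges v).

(* A finite path is given by its source [v] and its list of edges, which is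
   empty for the path of length 0 at [v]. *)
Fixpoint is_path v (p : seq (edge E)) : Prop :=
  if p is e :: p' then src e = v /\ is_path (rng e) p' else True.

Definition path_range v (p : seq (edge E)) : vertex E :=
  last v [seq rng e | e <- p].

Fixpoint saturation_step (n : nat) V : set (vertex E) :=
  match n with
  | 0 => [set v | exists u p, [/\ V u, is_path u p & path_range u p = v]]
  | m.+1 => saturation_step m V `|`
      [set v | regular v /\ (@rng E) @` out_edges v `<=` saturation_step m V]
  end.

Definition saturation V : set (vertex E) :=
  \bigcup_(n in [set: nat]) saturation_step n V.

End Graphs.

Definition graph_iso (E F : graph) : Prop :=
  exists (f0 : vertex E -> vertex F) (f1 : edge E -> edge F),
    [/\ bijective f0, bijective f1,
        forall e, src (f1 e) = f0 (src e) & forall e, rng (f1 e) = f0 (rng e)].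

(** * Moves *)

Section MoveS.
Variables (E : graph) (w : vertex E) (w_source : is_source w).

Fact moveS_rng_neq (e : edge E) : rng e != w.
Proof.
apply/eqP => rew; have : in_edges w e by [].
by rewrite w_source.
Qed.

Definition moveS : graph :=
  @Graph {v : vertex E | v != w} {e : edge E | src e != w}
    (fun e => exist _ (src (val e)) (valP e))
    (fun e => exist _ (rng (val e)) (moveS_rng_neq (val e))).

End MoveS.

(* In the moves (O) and (I) the partition of the edges at [w] is given by the
   map [c] that sends an edge to the index of its block, so that
   [E_i = s^-1(w) `&` c @^-1` [set i]], resp. with r^-1(w). The values of [c] at
   the other edges are irrelevant. *)
Definition indexed_partition (T : Type) (n : nat) (A : set T) (c : T -> 'I_n) :
    Prop :=
  forall i, A `&` c @^-1` [set i] !=set0.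

Section Splitting.
Variables (E : graph) (w : vertex E) (n : nat).

(* [inl v] stands for v^1 with v <> w, and [inr i] for w^i. *)
Definition split_vertex : countType := ({v : vertex E | v != w} + 'I_n)%type.

(* The copy of [v] with superscript [i] if [v = w], and v^1 otherwise. *)
Definition vertex_copy (v : vertex E) (i : 'I_n) : split_vertex :=
  if insub v is Some u then inl u else inr i.

Variable c : edge E -> 'I_n.

Definition moveO : graph :=
  @Graph split_vertex
    ({e : edge E | rng e != w} + {e : edge E | rng e == w} * 'I_n)%type
    (fun x => match x with
              | inl e => vertex_copy (src (val e)) (c (val e))
              | inr (e, i) => vertex_copy (src (val e)) (c (val e))
              end)
    (fun x => match x with
              | inl e => inl (exist _ (rng (val e)) (valP e))
              | inr (e, i) => inr i
              end).

Definition moveI : graph :=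
  @Graph split_vertex
    ({e : edge E | src e != w} + {e : edge E | src e == w} * 'I_n)%type
    (fun x => match x with
              | inl e => inl (exist _ (src (val e)) (valP e))
              | inr (e, i) => inr i
              end)
    (fun x => match x with
              | inl e => vertex_copy (rng (val e)) (c (val e))
              | inr (e, i) => vertex_copy (rng (val e)) (c (val e))
              end).

End Splitting.

Section MoveR.
Variables (E : graph) (w x : vertex E) (f : edge E).
Hypotheses (w_in : (@src E) @` in_edges w = [set x])
           (w_out : out_edges w = [set f])
           (f_rng : rng f != w).

Fact moveR_src_neq (e : edge E) : e != f -> src e != w.
Proof.
move=> ef; apply/eqP => sew.
have : out_edges w e by [].
by rewrite w_out => /eqP; rewrite (negPf ef).
Qed.

Fact moveR_x_neq : x != w.
Proof.
have : [set x] x by [].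
rewrite -w_in => -[e rew <-]; apply: moveR_src_neq.
by apply: contra f_rng => /eqP <-; rewrite rew.
Qed.

(* [inr e] stands for the new edge e_f, where e ranges over r^-1(w). *)
Definition moveR : graph :=
  @Graph {v : vertex E | v != w}
    ({e : edge E | (e != f) && (rng e != w)} + {e : edge E | rng e == w})%type
    (fun y => match y with
              | inl e => exist _ (src (val e))
                           (moveR_src_neq (proj1 (andP (valP e))))
              | inr e => exist _ x moveR_x_neq
              end)
    (fun y => match y with
              | inl e => exist _ (rng (val e)) (proj2 (andP (valP e)))
              | inr e => exist _ (rng f) f_rng
              end).

End MoveR.

(* [move E F]: F is, up to isomorphism, obtained from E by one of the moves. *)
Inductive move (E F : graph) : Prop :=
| MoveS (w : vertex E) (w_source : is_source w) of
    regular w & graph_iso (moveS w_source) F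
| MoveO (w : vertex E) (n : nat) (c : edge E -> 'I_n) of
    ~ is_sink w & indexed_partition (out_edges w) c
    & (forall i j, infinite_set (out_edges w `&` c @^-1` [set i]) ->
                   infinite_set (out_edges w `&` c @^-1` [set j]) -> i = j)
    & graph_iso (moveO w c) F
| MoveI (w : vertex E) (n : nat) (c : edge E -> 'I_n) of
    regular w & ~ is_source w & indexed_partition (in_edges w) c
    & graph_iso (moveI w c) F
| MoveR (w x : vertex E) (f : edge E)
    (w_in : (@src E) @` in_edges w = [set x])
    (w_out : out_edges w = [set f]) (f_rng : rng f != w) of
    regular w & graph_iso (moveR w_in w_out f_rng) F.

Definition move_equivalent (E F : graph) : Prop :=
  exists (n : nat) (G : nat -> graph),
    [/\ graph_iso E (G 0), graph_iso (G n) F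
      & forall i, (i < n)%N -> move (G i) (G i.+1) \/ move (G i.+1) (G i)].

(** * Leavitt path algebras *)

Section Leavitt.
Variables (K : fieldType) (E : graph).

Variant leavitt_gen : Type :=
| LVertex of vertex E
| LEdge of edge E
| LGhost of edge E.

Local Notation term := (aterm K leavitt_gen).
Local Notation tv v := (Gen (LVertex v) : term).
Local Notation te e := (Gen (LEdge e) : term).
Local Notation tg e := (Gen (LGhost e) : term).

Variant leavitt_rel : term -> term -> Prop :=
| L_idem v : leavitt_rel (Mul (tv v) (tv v)) (tv v)
| L_orth v w : v <> w -> leavitt_rel (Mul (tv v) (tv w)) Zero
| L_src e : leavitt_rel (Mul (tv (src e)) (te e)) (te e)
| L_rng e : leavitt_rel (Mul (te e) (tv (rng e))) (te e)
| L_ghost_rng e : leavitt_rel (Mul (tv (rng e)) (tg e)) (tg e)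
| L_ghost_src e : leavitt_rel (Mul (tg e) (tv (src e))) (tg e)
| L_CK1 e : leavitt_rel (Mul (tg e) (te e)) (tv (rng e))
| L_CK1_orth e f : e <> f -> leavitt_rel (Mul (tg e) (te f)) Zero
| L_CK2 v (l : seq (edge E)) :
    (* [l] lists the edges of s^-1(v) without repetition *)
    regular v -> uniq l -> [set` l] = out_edges v ->
    leavitt_rel (tv v)
      (foldr (fun e t => Add (Mul (te e) (tg e)) t) Zero l).

Definition leavitt : nuAlgType K := presalg leavitt_rel.

Definition lvertex (v : vertex E) : leavitt :=
  presalg_of leavitt_rel (Gen (LVertex v)).

(* The finite sums of elements of v L_K(E) w with v, w in V. *)
Definition corner (V : set (vertex E)) : set leavitt :=
  [set x | exists s : seq (vertex E * leavitt * vertex E),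
     (forall t, t \in s -> V t.1.1 /\ V t.2) /\
     x = \sum_(t <- s) (lvertex t.1.1 * t.1.2 * lvertex t.2)%g].

End Leavitt.

Arguments corner K {E} V.

(* Fullness of the corner V L_K(E) V, which does not involve K. *)
Definition full_corner (E : graph) (V : set (vertex E)) : Prop :=
  saturation V = [set: vertex E].

(** * Morita equivalence *)

Record category : Type := Category {
  obj : Type;
  hom : obj -> obj -> Type;
  idm : forall a, hom a a;
  ccomp : forall a b c, hom b c -> hom a b -> hom a c;
  ccomp1m : forall a b (f : hom a b), ccomp (idm b) f = f;
  ccompm1 : forall a b (f : hom a b), ccomp f (idm a) = f;
  ccompA : forall a b c d (f : hom c d) (g : hom b c) (h : hom a b),
    ccomp f (ccomp g h) = ccomp (ccomp f g) h
}.
Arguments hom {C} _ _ : rename.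
Arguments idm {C} a : rename.
Arguments ccomp {C a b c} _ _ : rename.

Record functor (C D : category) : Type := Functor {
  fobj :> obj C -> obj D;
  fmap : forall a b, hom a b -> hom (fobj a) (fobj b);
  fmap1 : forall a, fmap (idm a) = idm (fobj a);
  fmapM : forall a b c (f : hom b c) (g : hom a b),
    fmap (ccomp f g) = ccomp (fmap f) (fmap g)
}.
Arguments fmap {C D} F {a b} : rename.

Definition idf (C : category) : functor C C :=
  @Functor C C id (fun a b f => f) (fun a => erefl) (fun a b c f g => erefl).

Section CompFunctor.
Variables (C D B : category) (G : functor D B) (F : functor C D).

Fact compf1 a : fmap G (fmap F (idm a)) = idm (G (F a)).
Proof. by rewrite !fmap1. Qed.

Fact compfM a b c (f : hom b c) (g : hom a b) :
  fmap G (fmap F (ccomp f g)) = ccomp (fmap G (fmap F f)) (fmap G (fmap F g)).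
Proof. by rewrite !fmapM. Qed.

Definition compf : functor C B :=
  @Functor C B (fun a => G (F a)) (fun a b f => fmap G (fmap F f))
    compf1 compfM.

End CompFunctor.

Definition natural_iso (C D : category) (F G : functor C D) : Prop :=
  exists (t : forall a, hom (F a) (G a)) (u : forall a, hom (G a) (F a)),
    [/\ forall a b (f : hom a b), ccomp (t b) (fmap F f) = ccomp (fmap G f) (t a),
        forall a, ccomp (u a) (t a) = idm (F a)
      & forall a, ccomp (t a) (u a) = idm (G a)].

Definition equivalent_categories (C D : category) : Prop :=
  exists (F : functor C D) (G : functor D C),
    natural_iso (compf G F) (idf C) /\ natural_iso (compf F G) (idf D).

Section UnitalModules.
Variable R : nuRingType.

(* Unital left R-modules, i.e. those with R M = M. *)
Record umod : Type := UMod {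
  umod_sort :> zmodType;
  umod_act : R -> umod_sort -> umod_sort;
  umod_actM : forall a b m, umod_act (a * b)%g m = umod_act a (umod_act b m);
  umod_actDl : forall a b m, umod_act (a + b) m = umod_act a m + umod_act b m;
  umod_actDr : forall a m n, umod_act a (m + n) = umod_act a m + umod_act a n;
  umod_unital : forall m, exists s : seq (R * umod_sort),
    m = \sum_(t <- s) umod_act t.1 t.2
}.

Definition is_umod_hom (M N : umod) (f : M -> N) : Prop :=
  {morph f : x y / x + y} /\ forall a, {morph f : m / umod_act a m}.

Definition umod_hom (M N : umod) : Type := {f : M -> N | is_umod_hom f}.

Fact umod_hom_eq (M N : umod) (f g : umod_hom M N) : sval f = sval g -> f = g.
Proof. by case: f g => [f hf] [g hg] /= fg; apply: eq_exist. Qed.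

Fact umod_id_hom (M : umod) : is_umod_hom (id : M -> M).
Proof. by []. Qed.

Fact umod_comp_hom (M N P : umod) (f : umod_hom N P) (g : umod_hom M N) :
  is_umod_hom (sval f \o sval g).
Proof.
case: f g => [f [fD fa]] [g [gD ga]]; split=> [x y|a x] /=.
  by rewrite gD fD.
by rewrite ga fa.
Qed.

Definition umod_id (M : umod) : umod_hom M M := exist _ _ (umod_id_hom M).
Definition umod_comp (M N P : umod) (f : umod_hom N P) (g : umod_hom M N) :
  umod_hom M P := exist _ _ (umod_comp_hom f g).

Fact umod_comp1m M N (f : umod_hom M N) : umod_comp (umod_id N) f = f.
Proof. exact: umod_hom_eq. Qed.

Fact umod_compm1 M N (f : umod_hom M N) : umod_comp f (umod_id M) = f.
Proof. exact: umod_hom_eq. Qed.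

Fact umod_compA M N P Q
    (f : umod_hom P Q) (g : umod_hom N P) (h : umod_hom M N) :
  umod_comp f (umod_comp g h) = umod_comp (umod_comp f g) h.
Proof. exact: umod_hom_eq. Qed.

Definition umod_category : category :=
  Category umod_comp1m umod_compm1 umod_compA.

End UnitalModules.

(* Meant for rings with local units, where it is the usual notion. *)
Definition morita_equivalent (R S : nuRingType) : Prop :=
  equivalent_categories (umod_category R) (umod_category S).

(* Main.v *)
Require Import Defs.
From HB Require Import structures.
From mathcomp Require Import all_boot all_order all_algebra.
From mathcomp Require Import boolp classical_sets functions cardinality.

Set Implicit Arguments.
Unset Strict Implicit.
Unset Printing Implicit Defensive.

Import GRing.Theory.
Local Open Scope classical_set_scope.
Local Open Scope ring_scope.

(** Every move relates two graphs whose Leavitt path algebras have isomorphic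
full corners; a full corner is Morita equivalent to the whole algebra, so both
claims follow from one chain of such relations.

The moves (S), (R) and (I), and graph isomorphisms, are instances of one
construction. Let [T] be a set of regular vertices such that no edge goes from
[T] to [T]. The collapse of [T] deletes [T] and replaces each path [e f] through
a vertex of [T] by a single edge. In L(E) a regular vertex is the sum of the
[f f^*] over the edges [f] that leave it, hence is equivalent to the sum of their
ranges: nothing is lost by deleting [T], and the algebra of the collapse is the
corner of L(E) at the complement of [T] ([collapse_corner_iso]). The moves (S)
and (R) collapse [{w}]. For (I), put a new vertex on the edges of each block on
their way to [w]: collapsing the new vertices of this graph gives [E] back, and
collapsing [w] gives the in-splitting ([in_delay_collapse], [moveI_collapse]).
The move (O) splits the idempotent [w] into orthogonal pieces without changing
the algebra, and the two isomorphisms are written down on generators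
([moveO_iso]).

In the collapse, the map L(F) -> L(E) exists by generators and relations. It is
injective because L(E) acts by matrices over L(F), in such a way that the image
of [b] becomes the matrix with the single entry [b] ([collapse_hom_inj]). Its
image is the corner because each vertex [a] of [E] is a finite sum of products
[u u^*] with [u] a path from [a] out of [T], and the elements [u^* x u'] lie in
the image when [x] is a generator, hence always ([corner_transfer]).

For the Morita equivalence, a full corner [A] of a ring [R] with local units
gives the functor that sends [M] to [A M]. It is faithful and full since [A M]
generates [M] and since an element of a module killed by [A R] is zero; it is
essentially surjective since the [A]-module [N] is the cut of [R A (x) N], here
realised as a module of functions ([corner_morita]). *)

Local Notation "x ** y" := (x * y)%g (at level 40, left associativity).

(** * Rings without unit *)

Section NonunitalRing.
Variable R : nuRingType.
Implicit Types x y z : R.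

Lemma numul0r x : 0 ** x = 0.
Proof. by apply: (addrI (0 ** x)); rewrite -numulDl !addr0. Qed.

Lemma numulr0 x : x ** 0 = 0.
Proof. by apply: (addrI (x ** 0)); rewrite -numulDr !addr0. Qed.

Lemma numulNr x y : (- x) ** y = - (x ** y).
Proof. by apply: (addrI (x ** y)); rewrite -numulDl !subrr numul0r. Qed.

Lemma numulrN x y : x ** (- y) = - (x ** y).
Proof. by apply: (addrI (x ** y)); rewrite -numulDr !subrr numulr0. Qed.

Lemma numulBl x y z : (x - y) ** z = x ** z - y ** z.
Proof. by rewrite numulDl numulNr. Qed.

Lemma numulBr x y z : x ** (y - z) = x ** y - x ** z.
Proof. by rewrite numulDr numulrN. Qed.

Lemma numul_suml (I : Type) (s : seq I) (P : pred I) (F : I -> R) y :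
  (\sum_(i <- s | P i) F i) ** y = \sum_(i <- s | P i) (F i ** y).
Proof.
exact: (big_morph (fun x => x ** y) (fun a b => numulDl a b y) (numul0r y)).
Qed.

Lemma numul_sumr (I : Type) (s : seq I) (P : pred I) (F : I -> R) y :
  y ** (\sum_(i <- s | P i) F i) = \sum_(i <- s | P i) (y ** F i).
Proof.
exact: (big_morph (fun x => y ** x) (fun a b => numulDr y a b) (numulr0 y)).
Qed.

End NonunitalRing.

Section Morphism.
Variable (K : fieldType) (X : Type) (rel : aterm K X -> aterm K X -> Prop).
Local Notation P := (presalg rel).

Lemma presalg_ofD t u :
  presalg_of rel (Add t u) = presalg_of rel t + presalg_of rel u.
Proof. by rewrite /GRing.add /= pa_addE. Qed.

Lemma presalg_ofM t u :
  presalg_of rel (Mul t u) = presalg_of rel t ** presalg_of rel u.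
Proof. by rewrite /monoid.mul /= pa_mulE. Qed.

Lemma presalg_ofZ k t :
  presalg_of rel (Scale k t) = k *: presalg_of rel t.
Proof. by rewrite /GRing.scale /= pa_scaleE. Qed.

Lemma presalg_of0 : presalg_of rel Zero = 0.
Proof. by []. Qed.

Lemma presalg_ind (S : P -> Prop) :
    (forall x, S (presalg_of rel (Gen x))) -> S 0 ->
    (forall a b, S a -> S b -> S (a + b)) ->
    (forall a b, S a -> S b -> S (a ** b)) ->
    (forall k a, S a -> S (k *: a)) ->
  forall a, S a.
Proof.
move=> Sg S0 SD SM SZ; apply: presalgW.
elim=> [x||t St u Su|t St u Su|k t St] //.
- by rewrite presalg_ofD; apply: SD.
- by rewrite presalg_ofM; apply: SM.
- by rewrite presalg_ofZ; apply: SZ.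
Qed.

End Morphism.

(** The source of a [nualg_morphism] is a presented algebra; here it is
arbitrary. *)
Definition nualg_hom (K : fieldType) (A B : nuAlgType K) (f : A -> B) : Prop :=
  [/\ {morph f : x y / x + y}, {morph f : x y / x ** y}
    & forall k : K, {morph f : x / k *: x}].

Section Hom.
Variables (K : fieldType) (A B : nuAlgType K) (f : A -> B).
Hypothesis fH : nualg_hom f.

Lemma homD x y : f (x + y) = f x + f y. Proof. by case: fH. Qed.
Lemma homM x y : f (x ** y) = f x ** f y. Proof. by case: fH. Qed.
Lemma homZ k x : f (k *: x) = k *: f x. Proof. by case: fH => _ _ ->. Qed.
Lemma hom0 : f 0 = 0. Proof. by have := homZ 0 0; rewrite !scale0r. Qed.
Lemma homN x : f (- x) = - f x. Proof. by rewrite -scaleN1r homZ scaleN1r. Qed.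
Lemma hom_sum (I : Type) (s : seq I) (P : pred I) (F : I -> A) :
  f (\sum_(i <- s | P i) F i) = \sum_(i <- s | P i) f (F i).
Proof. exact: (big_morph f homD hom0). Qed.

End Hom.

Lemma hom_id (K : fieldType) (A : nuAlgType K) : nualg_hom (@id A).
Proof. by []. Qed.

Lemma hom_comp (K : fieldType) (A B C : nuAlgType K) (g : B -> C) (f : A -> B) :
  nualg_hom g -> nualg_hom f -> nualg_hom (g \o f).
Proof.
move=> gH fH; split=> [x y|x y|k x] /=.
- by rewrite (homD fH) (homD gH).
- by rewrite (homM fH) (homM gH).
- by rewrite (homZ fH) (homZ gH).
Qed.

Lemma presalg_hom_ext (K : fieldType) (X : Type)
    (rel : aterm K X -> aterm K X -> Prop) (B : nuAlgType K)
    (f g : presalg rel -> B) :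
    nualg_hom f -> nualg_hom g ->
    (forall x, f (presalg_of rel (Gen x)) = g (presalg_of rel (Gen x))) ->
  f =1 g.
Proof.
move=> fH gH fg; apply: presalg_ind => //=.
- by rewrite (hom0 fH) (hom0 gH).
- by move=> a b fa fb; rewrite (homD fH) (homD gH) fa fb.
- by move=> a b fa fb; rewrite (homM fH) (homM gH) fa fb.
- by move=> k a fa; rewrite (homZ fH) (homZ gH) fa.
Qed.

(** * Linear endomorphisms *)

Section Endomorphisms.
Variables (K : fieldType) (P : lmodType K).

Definition is_linear : {pred P -> P} :=
  fun f => `[< forall k x y, f (k *: x + y) = k *: f x + f y >].

Lemma is_linear_closed : submod_closed is_linear.
Proof.
split; first by apply/asboolP => k x y; rewrite [LHS]/0 /= scaler0 addr0.
move=> a f g /asboolP fL /asboolP gL; apply/asboolP => k x y /=.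
rewrite !fctE fL gL !scalerDr !scalerA (mulrC a k) -!addrA; congr (_ + _).
by rewrite addrCA.
Qed.

HB.instance Definition _ := GRing.isSubmodClosed.Build K _ is_linear is_linear_closed.

Definition endo : Type := {f : P -> P | is_linear f}.
HB.instance Definition _ := SubType.on endo.
HB.instance Definition _ := Choice.on endo.
HB.instance Definition _ := [SubChoice_isSubLmodule of endo by <:].

Lemma endo_ext (f g : endo) : (forall x, val f x = val g x) -> f = g.
Proof. by move=> fg; apply/val_inj/funext. Qed.

Lemma endoL (f : endo) k x y : val f (k *: x + y) = k *: val f x + val f y.
Proof. by case: f => f /= /asboolP. Qed.

Lemma endoD (f : endo) x y : val f (x + y) = val f x + val f y.
Proof. by rewrite -[x in LHS]scale1r endoL scale1r. Qed.

Lemma endo0 (f : endo) : val f 0 = 0.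
Proof. by apply: (addrI (val f 0)); rewrite -endoD !addr0. Qed.

Lemma endoZ (f : endo) k x : val f (k *: x) = k *: val f x.
Proof. by rewrite -[k *: x in LHS]addr0 endoL endo0 addr0. Qed.

Fact endo_mul_subproof (f g : endo) : is_linear (val f \o val g).
Proof. by apply/asboolP => k x y /=; rewrite !endoL. Qed.

Definition endo_mul (f g : endo) : endo :=
  exist (fun h => is_linear h) _ (endo_mul_subproof f g).

Fact endo_mulA : associative endo_mul.
Proof. by move=> f g h; apply: endo_ext. Qed.

HB.instance Definition _ := isSemigroup.Build endo endo_mulA.

Lemma endoME (f g : endo) x : val (f ** g) x = val f (val g x).
Proof. by []. Qed.
Lemma endoDE (f g : endo) x : val (f + g) x = val f x + val g x.
Proof. by []. Qed.
Lemma endoZE k (f : endo) x : val (k *: f) x = k *: val f x.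
Proof. by []. Qed.

Fact endo_mulDl (f g h : endo) : (f + g) ** h = f ** h + g ** h.
Proof. by apply: endo_ext. Qed.
Fact endo_mulDr (f g h : endo) : f ** (g + h) = f ** g + f ** h.
Proof. by apply: endo_ext => x; rewrite !(endoME, endoDE, endoD). Qed.

HB.instance Definition _ := isNonunitalRing.Build endo endo_mulDl endo_mulDr.

Fact endo_scaleAl (k : K) (f g : endo) : k *: (f ** g) = (k *: f) ** g.
Proof. by apply: endo_ext. Qed.
Fact endo_scaleAr (k : K) (f g : endo) : k *: (f ** g) = f ** (k *: g).
Proof. by apply: endo_ext => x; rewrite !(endoME, endoZE, endoZ). Qed.

HB.instance Definition _ :=
  isNonunitalAlgebra.Build K endo endo_scaleAl endo_scaleAr.

End Endomorphisms.

(** * Elementary operators *)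

Section ElementaryOperators.
Variables (K : fieldType) (B : nuAlgType K) (Y : eqType).

Local Notation P := (Y -> B).

Definition emx_fun (y : Y) (b : B) (z : Y) (g : P) : P :=
  fun y' => if y' == y then b ** g z else 0.

Fact emx_subproof y b z : is_linear (emx_fun y b z).
Proof.
apply/asboolP => k g h; apply/funext => y'.
change ((if y' == y then b ** (k *: g z + h z) else 0) =
        k *: (if y' == y then b ** g z else 0) +
        (if y' == y then b ** h z else 0)).
case: eqP => _; first by rewrite numulDr nuscaleAr.
by rewrite scaler0 addr0.
Qed.

(** Functions [Y -> B] are column vectors; this is the matrix whose only nonzero
entry is [b], at position [(y, z)]. Working with operators instead of matrices
avoids any finiteness condition on [Y]. *)
Definition emx y b z : endo P :=
  exist (fun h => is_linear h) _ (emx_subproof y b z).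

Lemma emxE y b z (g : P) y' : val (emx y b z) g y' = if y' == y then b ** g z else 0.
Proof. by []. Qed.

Lemma emxM y b z b' z' : emx y b z ** emx z b' z' = emx y (b ** b') z'.
Proof.
apply: endo_ext => g; apply/funext => y'.
by rewrite endoME !emxE eqxx mulgA.
Qed.

Lemma emxM0 y b z y' b' z' : z != y' -> emx y b z ** emx y' b' z' = 0.
Proof.
move=> /negPf zy; apply: endo_ext => g; apply/funext => t.
by rewrite endoME !emxE zy numulr0 if_same.
Qed.

Lemma emxD y b b' z : emx y (b + b') z = emx y b z + emx y b' z.
Proof.
apply: endo_ext => g; apply/funext => t; rewrite endoDE.
change ((if t == y then (b + b') ** g z else 0) =
        (if t == y then b ** g z else 0) + (if t == y then b' ** g z else 0)).
by case: eqP => _; [rewrite numulDl | rewrite addr0].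
Qed.

Lemma emxZ y k b z : emx y (k *: b) z = k *: emx y b z.
Proof.
apply: endo_ext => g; apply/funext => t; rewrite endoZE.
change ((if t == y then (k *: b) ** g z else 0) =
        k *: (if t == y then b ** g z else 0)).
by case: eqP => _; [rewrite nuscaleAl | rewrite scaler0].
Qed.

Lemma emx_hom y : nualg_hom (fun b => emx y b y).
Proof. by split=> [b b'|b b'|k b]; rewrite ?emxD ?emxM ?emxZ. Qed.

Lemma emx0 y z : emx y 0 z = 0.
Proof. by have := emxZ y 0 0 z; rewrite !scale0r. Qed.

Lemma emx_sum (I : Type) (s : seq I) (Q : pred I) (F : I -> B) y z :
  emx y (\sum_(i <- s | Q i) F i) z = \sum_(i <- s | Q i) emx y (F i) z.
Proof.
exact: (big_morph (fun b => emx y b z) (fun b b' => emxD y b b' z) (emx0 y z)).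
Qed.

Lemma emx_suml (s : seq Y) (f : Y -> Y) (a : Y -> B) z c t :
    uniq s -> z \in s ->
  (\sum_(y <- s) emx (f y) (a y) y) ** emx z c t = emx (f z) (a z ** c) t.
Proof.
move=> sU zs; rewrite numul_suml (bigD1_seq z) //= emxM big1 ?addr0 // => y yz.
by rewrite emxM0.
Qed.

Lemma emx_sumr (s : seq Y) (f : Y -> Y) (a : Y -> B) z c t :
    uniq s -> z \in s ->
  emx t c z ** (\sum_(y <- s) emx y (a y) (f y)) = emx t (c ** a z) (f z).
Proof.
move=> sU zs; rewrite numul_sumr (bigD1_seq z) //= emxM big1 ?addr0 // => y yz.
by rewrite emxM0 // eq_sym.
Qed.

Lemma emx_sumM (s : seq Y) (f g : Y -> Y) (a b : Y -> B) : uniq s ->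
  (\sum_(y <- s) emx (f y) (a y) y) ** (\sum_(y <- s) emx y (b y) (g y)) =
  \sum_(y <- s) emx (f y) (a y ** b y) (g y).
Proof.
move=> sU; rewrite numul_suml big_seq [RHS]big_seq; apply: eq_bigr => y ys.
by rewrite emx_sumr.
Qed.

End ElementaryOperators.

(** * Leavitt path algebras *)

Lemma mem_out_list (E : graph) (v : vertex E) (l : seq (edge E)) :
  [set` l] = out_edges v -> forall e, (e \in l) = (src e == v).
Proof.
move=> lE e; apply/idP/eqP => [el|ev].
  by have : [set` l] e by []; rewrite lE.
by have : out_edges v e by []; rewrite -lE.
Qed.

Section LeavittFamily.
Variables (K : fieldType) (E : graph).

Definition ledge (e : edge E) : leavitt K E := presalg_of _ (Gen (LEdge e)).
Definition lghost (e : edge E) : leavitt K E := presalg_of _ (Gen (LGhost e)).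

(** A Leavitt family in [A]: by the universal property, the same thing as an
algebra morphism from the Leavitt path algebra to [A]. *)
Record leavitt_family (A : nuAlgType K) (pv : vertex E -> A)
    (pe pg : edge E -> A) : Prop := LeavittFamily {
  lf_idem : forall v, pv v ** pv v = pv v;
  lf_orth : forall v w, v <> w -> pv v ** pv w = 0;
  lf_src : forall e, pv (src e) ** pe e = pe e;
  lf_rng : forall e, pe e ** pv (rng e) = pe e;
  lf_ghost_rng : forall e, pv (rng e) ** pg e = pg e;
  lf_ghost_src : forall e, pg e ** pv (src e) = pg e;
  lf_CK1 : forall e, pg e ** pe e = pv (rng e);
  lf_CK1_orth : forall e f, e <> f -> pg e ** pe f = 0;
  lf_CK2 : forall v l, regular v -> uniq l -> [set` l] = out_edges v ->
    pv v = \sum_(e <- l) pe e ** pg e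
}.

Lemma leavitt_is_family : leavitt_family (lvertex K (E := E)) ledge lghost.
Proof.
have relE (t u : aterm K (leavitt_gen E)) : leavitt_rel t u ->
    presalg_of (@leavitt_rel K E) t = presalg_of (@leavitt_rel K E) u.
  by move=> tu; apply/presalg_eqP; apply: ac_rel.
split.
- by move=> v; rewrite -presalg_ofM; apply/relE/L_idem.
- by move=> v w vw; rewrite -presalg_ofM; apply/relE/L_orth.
- by move=> e; rewrite -presalg_ofM; apply/relE/L_src.
- by move=> e; rewrite -presalg_ofM; apply/relE/L_rng.
- by move=> e; rewrite -presalg_ofM; apply/relE/L_ghost_rng.
- by move=> e; rewrite -presalg_ofM; apply/relE/L_ghost_src.
- by move=> e; rewrite -presalg_ofM; apply/relE/L_CK1.
- by move=> e f ef; rewrite -presalg_ofM; apply/relE/L_CK1_orth.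
- move=> v l vreg lU lE; rewrite /lvertex (relE _ _ (L_CK2 _ vreg lU lE)).
  elim: l {lU lE} => [|e l IHl] /=; first by rewrite big_nil presalg_of0.
  by rewrite big_cons presalg_ofD presalg_ofM IHl.
Qed.

Lemma leavitt_lift (A : nuAlgType K) pv pe pg :
    @leavitt_family A pv pe pg ->
  exists f : leavitt K E -> A,
    [/\ nualg_hom f, forall v, f (lvertex K v) = pv v,
        forall e, f (ledge e) = pe e & forall e, f (lghost e) = pg e].
Proof.
move=> fam.
pose g x := match x with
            | LVertex v => pv v | LEdge e => pe e | LGhost e => pg e end.
have gP t u : leavitt_rel t u -> aeval g t = aeval g u.
  case=> /=.
  - exact: lf_idem fam.
  - exact: lf_orth fam.
  - exact: lf_src fam.
  - exact: lf_rng fam.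
  - exact: lf_ghost_rng fam.
  - exact: lf_ghost_src fam.
  - exact: lf_CK1 fam.
  - exact: lf_CK1_orth fam.
  - move=> v l vreg lU lE; rewrite (lf_CK2 fam vreg lU lE).
    elim: l {lU lE} => [|e l IHl] /=; first by rewrite big_nil.
    by rewrite big_cons IHl.
have [f [[fH fg] _]] := presalg_universal gP.
by exists f; split=> // x; apply: fg.
Qed.

Lemma leavitt_ind (S : leavitt K E -> Prop) :
    (forall v, S (lvertex K v)) -> (forall e, S (ledge e)) ->
    (forall e, S (lghost e)) -> S 0 ->
    (forall a b, S a -> S b -> S (a + b)) ->
    (forall a b, S a -> S b -> S (a ** b)) ->
    (forall k a, S a -> S (k *: a)) ->
  forall a, S a.
Proof. by move=> Sv Se Sg S0 SD SM SZ; apply: presalg_ind => // -[]. Qed.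

Lemma leavitt_hom_ext (A : nuAlgType K) (f g : leavitt K E -> A) :
    nualg_hom f -> nualg_hom g ->
    (forall v, f (lvertex K v) = g (lvertex K v)) ->
    (forall e, f (ledge e) = g (ledge e)) ->
    (forall e, f (lghost e) = g (lghost e)) -> f =1 g.
Proof. by move=> fH gH fgv fge fgg; apply: presalg_hom_ext => // -[]. Qed.

End LeavittFamily.

Section LocalUnits.
Variables (K : fieldType) (E : graph).
Implicit Types (v w : vertex E) (s t : seq (vertex E)) (x y : leavitt K E).

Local Notation lv := (lvertex K (E := E)).
Local Notation le := (ledge K (E := E)).
Local Notation lg := (lghost K (E := E)).

Let fam := leavitt_is_family K E.

Definition usum s : leavitt K E := \sum_(v <- s) lv v.

Lemma lvertexM v w : lv v ** lv w = if v == w then lv v else 0.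
Proof. by case: eqP => [->|/(lf_orth fam)//]; rewrite (lf_idem fam). Qed.

Lemma lvertex_usum v s : uniq s -> lv v ** usum s = if v \in s then lv v else 0.
Proof.
move=> sU; rewrite /usum numul_sumr.
case: ifPn => vs.
  rewrite (bigD1_seq v) //= lvertexM eqxx big1 ?addr0 // => w /negPf wv.
  by rewrite lvertexM eq_sym wv.
rewrite big_seq big1 // => w ws; rewrite lvertexM; case: eqP => // vw.
by rewrite vw ws in vs.
Qed.

Lemma usum_lvertex v s : uniq s -> usum s ** lv v = if v \in s then lv v else 0.
Proof.
move=> sU; rewrite /usum numul_suml.
case: ifPn => vs.
  rewrite (bigD1_seq v) //= lvertexM eqxx big1 ?addr0 // => w /negPf wv.
  by rewrite lvertexM wv.
rewrite big_seq big1 // => w ws; rewrite lvertexM; case: eqP => // vw.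
by rewrite -vw ws in vs.
Qed.

Lemma usumM s t : uniq t -> {subset s <= t} -> usum s ** usum t = usum s.
Proof.
move=> tU st; rewrite {1}/usum numul_suml /usum [RHS]big_seq [LHS]big_seq.
by apply: eq_bigr => v /st vt; rewrite lvertex_usum ?vt.
Qed.

Lemma usumMl s t : uniq t -> {subset s <= t} -> usum t ** usum s = usum s.
Proof.
move=> tU st; rewrite {2}/usum numul_sumr /usum [RHS]big_seq [LHS]big_seq.
by apply: eq_bigr => v /st vt; rewrite usum_lvertex ?vt.
Qed.

(** The algebra has no unit when there are infinitely many vertices; the sum of
a large enough finite set of vertices acts as a unit on a given element. *)
Definition supp s x := [/\ uniq s, usum s ** x = x & x ** usum s = x].

Lemma supp_sub s t x : supp s x -> uniq t -> {subset s <= t} -> supp t x.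
Proof.
move=> [sU sx xs] tU st; split=> //.
  by rewrite -sx mulgA usumMl.
by rewrite -{1}xs -mulgA usumM.
Qed.

Lemma supp_undup s t x y :
  supp s x -> supp t y -> supp (undup (s ++ t)) x /\ supp (undup (s ++ t)) y.
Proof.
move=> sx ty; split.
  by apply: (supp_sub sx); rewrite ?undup_uniq // => v vs; rewrite mem_undup mem_cat vs.
apply: (supp_sub ty); rewrite ?undup_uniq // => v vs.
by rewrite mem_undup mem_cat vs orbT.
Qed.

Lemma suppD s x y : supp s x -> supp s y -> supp s (x + y).
Proof.
by move=> [sU sx xs] [_ sy ys]; split; rewrite // ?numulDr ?numulDl ?sx ?sy ?xs ?ys.
Qed.

Lemma suppM s x y z : supp s x -> supp s y -> supp s (x ** z ** y).
Proof.
by move=> [sU sx xs] [_ sy ys]; split=> //; [rewrite !mulgA sx | rewrite -!mulgA ys].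
Qed.

Lemma supp0 s : uniq s -> supp s 0.
Proof. by move=> sU; split; rewrite ?numul0r ?numulr0. Qed.

Lemma suppZ s k x : supp s x -> supp s (k *: x).
Proof. by move=> [sU sx xs]; split; rewrite // -?nuscaleAr -?nuscaleAl ?sx ?xs. Qed.

Lemma supp_exists x : exists s, supp s x.
Proof.
elim/leavitt_ind: x => [v|e|e||x y|x y|k x].
- exists [:: v]; split; rewrite // ?usum_lvertex ?lvertex_usum //;
  by rewrite inE eqxx.
- exists (undup [:: src e; rng e]); rewrite /supp undup_uniq; split=> //.
    rewrite -(lf_src fam) mulgA usum_lvertex ?undup_uniq //.
    by rewrite mem_undup !inE eqxx.
  rewrite -(lf_rng fam) -mulgA lvertex_usum ?undup_uniq //.
  by rewrite mem_undup !inE eqxx orbT.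
- exists (undup [:: src e; rng e]); rewrite /supp undup_uniq; split=> //.
    rewrite -(lf_ghost_rng fam) mulgA usum_lvertex ?undup_uniq //.
    by rewrite mem_undup !inE eqxx orbT.
  rewrite -(lf_ghost_src fam) -mulgA lvertex_usum ?undup_uniq //.
  by rewrite mem_undup !inE eqxx.
- by exists [::]; apply: supp0.
- move=> [s sx] [t ty]; have [] := supp_undup sx ty.
  by exists (undup (s ++ t)); apply: suppD.
- move=> [s sx] [t ty]; have [[U ux _] [_ _ yu]] := supp_undup sx ty.
  exists (undup (s ++ t)); split=> //.
    by rewrite mulgA ux.
  by rewrite -mulgA yu.
- by move=> [s sx]; exists s; apply: suppZ.
Qed.

Lemma usum_id s : uniq s -> supp s (usum s).
Proof. by move=> sU; split; rewrite // usumM. Qed.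

(** The corner consists of the elements with a local unit made of vertices of
[V]; closure properties are easier to see in this form. *)
Lemma cornerP (V : set (vertex E)) x :
  corner K V x <-> exists s, supp s x /\ forall v, v \in s -> V v.
Proof.
split=> [[l [lV ->]]|[s [[sU sx xs] sV]]].
  elim: l lV => [|[[v a] w] l IHl] lV.
    by exists [::]; rewrite big_nil; split=> //; apply: supp0.
  have [|s [ss sV]] := IHl; first by move=> t tl; apply: lV; rewrite inE tl orbT.
  have [/= Vv Vw] := lV _ (mem_head _ _).
  have vwx : supp (undup [:: v; w]) (lv v ** a ** lv w).
    rewrite /supp undup_uniq; split=> //.
      by rewrite !mulgA usum_lvertex ?undup_uniq // mem_undup !inE eqxx.
    by rewrite -!mulgA lvertex_usum ?undup_uniq // mem_undup !inE eqxx orbT.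
  have [vx sx] := supp_undup vwx ss.
  exists (undup (undup [:: v; w] ++ s)); rewrite big_cons; split.
    exact: suppD.
  move=> u; rewrite mem_undup mem_cat mem_undup !inE => /orP[/orP[]/eqP->//|].
  exact: sV.
exists [seq (v, x, w) | v <- s, w <- s]; split.
  by move=> t /allpairsP[[v w] [/= vs ws ->]]; split; apply: sV.
rewrite big_allpairs_dep /= -{1}sx -{1}xs mulgA {1}/usum.
rewrite !numul_suml; apply: eq_bigr => v _.
by rewrite {1}/usum numul_sumr.
Qed.

Lemma corner_setT x : corner K [set: vertex E] x.
Proof. by apply/cornerP; have [s sx] := supp_exists x; exists s. Qed.

End LocalUnits.

Section Paths.
Variables (K : fieldType) (E : graph).
Implicit Types (v : vertex E) (p : seq (edge E)).

Local Notation lv := (lvertex K (E := E)).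
Local Notation le := (ledge K (E := E)).
Local Notation lg := (lghost K (E := E)).

Let fam := leavitt_is_family K E.

Fixpoint lpath v p : leavitt K E :=
  if p is e :: p' then le e ** lpath (rng e) p' else lv v.

Fixpoint gpath v p : leavitt K E :=
  if p is e :: p' then gpath (rng e) p' ** lg e else lv v.

Lemma lpath_src v p : is_path v p -> lv v ** lpath v p = lpath v p.
Proof.
case: p => [|e p] /=; first by rewrite (lf_idem fam).
by move=> [<- _]; rewrite mulgA (lf_src fam).
Qed.

Lemma gpath_src v p : is_path v p -> gpath v p ** lv v = gpath v p.
Proof.
case: p => [|e p] /=; first by rewrite (lf_idem fam).
by move=> [<- _]; rewrite -mulgA (lf_ghost_src fam).
Qed.

Lemma lpath_rng v p : lpath v p ** lv (path_range v p) = lpath v p.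
Proof.
rewrite /path_range; elim: p v => [|e p IHp] v /=; first by rewrite (lf_idem fam).
by rewrite -mulgA IHp.
Qed.

Lemma gpath_rng v p : lv (path_range v p) ** gpath v p = gpath v p.
Proof.
rewrite /path_range; elim: p v => [|e p IHp] v /=; first by rewrite (lf_idem fam).
by rewrite mulgA IHp.
Qed.

Lemma gpath_lpath v p : is_path v p ->
  gpath v p ** lpath v p = lv (path_range v p).
Proof.
rewrite /path_range; elim: p v => [|e p IHp] v /=; first by rewrite (lf_idem fam).
move=> [_ pP]; rewrite mulgA -(mulgA _ (lg e)) (lf_CK1 fam) -mulgA.
by rewrite lpath_src // IHp.
Qed.

Definition vertex_ideal (V : set (vertex E)) : set (leavitt K E) :=
  [set x | exists s : seq (leavitt K E * vertex E * leavitt K E),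
     (forall t, t \in s -> V t.1.2) /\
     x = \sum_(t <- s) t.1.1 ** lv t.1.2 ** t.2].

Lemma vertex_idealMM V x a b :
  vertex_ideal V x -> vertex_ideal V (a ** x ** b).
Proof.
move=> [s [sV ->]]; exists [seq (a ** t.1.1, t.1.2, t.2 ** b) | t <- s]; split.
  by move=> _ /mapP[t ts ->]; exact: (sV _ ts).
rewrite big_map /= numul_sumr numul_suml; apply: eq_bigr => t _.
by rewrite !mulgA.
Qed.

Lemma vertex_idealD V x y :
  vertex_ideal V x -> vertex_ideal V y -> vertex_ideal V (x + y).
Proof.
move=> [s [sV ->]] [t [tV ->]]; exists (s ++ t); split.
  by move=> u; rewrite mem_cat => /orP[/sV|/tV].
by rewrite big_cat.
Qed.

Lemma vertex_ideal0 V : vertex_ideal V 0.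
Proof. by exists [::]; rewrite big_nil. Qed.

Lemma vertex_ideal_sum V (I : eqType) (l : seq I) (F : I -> leavitt K E) :
    (forall i, i \in l -> vertex_ideal V (F i)) ->
  vertex_ideal V (\sum_(i <- l) F i).
Proof.
move=> FV; rewrite big_seq; elim/big_ind: _ => //; first exact: vertex_ideal0.
by move=> x y; apply: vertex_idealD.
Qed.

Lemma vertex_ideal_lvertex (V : set (vertex E)) v : V v -> vertex_ideal V (lv v).
Proof.
move=> Vv; exists [:: (lv v, v, lv v)]; split.
  by move=> t; rewrite inE => /eqP->.
by rewrite big_seq1 /= !(lf_idem fam).
Qed.

Lemma out_edges_list v : regular v ->
  exists2 l : seq (edge E), uniq l & [set` l] = out_edges v.
Proof.
move=> [_ /finite_seqP[l lE]]; exists (undup l); rewrite ?undup_uniq // lE.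
by apply/seteqP; split=> e /=; rewrite mem_undup.
Qed.

(** Both steps of the saturation stay in the ideal: the range of a path [p] from
[u] is [p^* u p], and a regular vertex is the sum of the [e r(e) e^*]. *)
Lemma saturation_ideal V v : saturation V v -> vertex_ideal V (lv v).
Proof.
move=> [n _]; elim: n v => [|n IHn] v /=.
  move=> [u [p [Vu pP <-]]]; rewrite -gpath_lpath // -(gpath_src pP).
  exact/vertex_idealMM/vertex_ideal_lvertex.
move=> [/IHn//|[vreg vV]]; have [l lU lE] := out_edges_list vreg.
rewrite (lf_CK2 fam vreg lU lE); apply: vertex_ideal_sum => e el.
rewrite -(lf_rng fam); apply/vertex_idealMM/IHn/vV; exists e => //.
by rewrite -lE.
Qed.

Lemma full_corner_ideal V : full_corner V -> forall x, vertex_ideal V x.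
Proof.
move=> Vfull x; have [s [_ sx _]] := supp_exists x.
rewrite -sx /usum numul_suml; apply: vertex_ideal_sum => v _.
rewrite -(lf_idem fam v); apply/vertex_idealMM/saturation_ideal.
by rewrite Vfull.
Qed.

End Paths.

(** * Isomorphisms onto corners *)

(** The pairs in [U a] play the role of a finite family of paths [u] from [a]
into [V], with their adjoints [u^*], such that the [u u^*] sum to [a]. Such a
family turns any element into a matrix of elements of the corner, and it suffices
to see that the matrices of the generators have their entries in the image of
[phi]. *)
Section CornerTransfer.
Variables (K : fieldType) (E F : graph) (V : set (vertex E)).
Variables (j : vertex F -> vertex E) (phi : leavitt K F -> leavitt K E).
Hypotheses (phiH : nualg_hom phi) (phi_inj : injective phi).
Hypotheses (j_inj : injective j) (jV : forall v, V (j v)).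
Hypothesis (phi_v : forall v, phi (lvertex K v) = lvertex K (j v)).
Variable U : vertex E -> seq (leavitt K E * leavitt K E).

Local Notation lv := (lvertex K (E := E)).
Local Notation le := (ledge K (E := E)).
Local Notation lg := (lghost K (E := E)).

Hypothesis U_sum : forall a, \sum_(u <- U a) u.1 ** u.2 = lv a.
Hypothesis U_V : forall v, V v -> (lv v, lv v) \in U v.
Hypothesis U_src : forall a u, u \in U a -> lv a ** u.1 = u.1.
Hypothesis U_rng : forall a u, u \in U a -> u.2 ** lv a = u.2.
Hypothesis U_vertex : forall a u u', u \in U a -> u' \in U a ->
  range phi (u.2 ** u'.1).
Hypothesis U_edge : forall e u u', u \in U (src e) -> u' \in U (rng e) ->
  range phi (u.2 ** le e ** u'.1).
Hypothesis U_ghost : forall e u u', u \in U (rng e) -> u' \in U (src e) ->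
  range phi (u.2 ** lg e ** u'.1).

Let rangeD x y : range phi x -> range phi y -> range phi (x + y).
Proof. by move=> [a _ <-] [b _ <-]; exists (a + b); rewrite ?(homD phiH). Qed.

Let rangeM x y : range phi x -> range phi y -> range phi (x ** y).
Proof. by move=> [a _ <-] [b _ <-]; exists (a ** b); rewrite ?(homM phiH). Qed.

Let range0 : range phi 0.
Proof. by exists 0; rewrite ?(hom0 phiH). Qed.

Let range_sum (I : eqType) (s : seq I) (G : I -> leavitt K E) :
  (forall i, i \in s -> range phi (G i)) -> range phi (\sum_(i <- s) G i).
Proof. by move=> sG; rewrite big_seq; elim/big_ind: _. Qed.

(** The property is stable under products because the local unit between the two
factors is a sum of terms [u u^*]. *)
Lemma transfer_range x a b u u' :
  u \in U a -> u' \in U b -> range phi (u.2 ** x ** u'.1).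
Proof.
(* A generator lives between two vertices [c] and [d], so that its product with
   elements attached to other vertices [a] and [b] vanishes. *)
pose cut c d (y : leavitt K E) := forall a b u u', u \in U a -> u' \in U b ->
  (c == a) && (d == b) || (u.2 ** (lv c ** y ** lv d) ** u'.1 == 0).
have cutP c d y : cut c d y.
  move=> {}a {}b {}u {}u' ua ub; case: eqVneq => [_|ca] /=; last first.
    rewrite !mulgA -(U_rng ua) -(mulgA u.2 (lv a)) lvertexM.
    by rewrite (eq_sym a) (negPf ca) numulr0 !numul0r.
  case: eqVneq => [//|db] /=; rewrite -(U_src ub) -!mulgA (mulgA (lv d) (lv b)) lvertexM.
  by rewrite (negPf db) numul0r !numulr0.
have fam := leavitt_is_family K E.
elim/leavitt_ind: x a b u u' => [v|e|e||x y IHx IHy|x y IHx IHy|k x IHx] a b u u' ua ub.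
- have := cutP v v (lv v) _ _ _ _ ua ub; rewrite !(lf_idem fam).
  case/orP => [/andP[/eqP va /eqP vb]|/eqP->//].
  by rewrite va (U_rng ua); apply: (@U_vertex a) => //; rewrite -va vb.
- have := cutP (src e) (rng e) (le e) _ _ _ _ ua ub.
  rewrite (lf_src fam) (lf_rng fam); case/orP => [/andP[/eqP ea /eqP eb]|/eqP->//].
  by apply: U_edge; rewrite ?ea ?eb.
- have := cutP (rng e) (src e) (lg e) _ _ _ _ ua ub.
  rewrite (lf_ghost_rng fam) (lf_ghost_src fam).
  case/orP => [/andP[/eqP ea /eqP eb]|/eqP->//].
  by apply: U_ghost; rewrite ?ea ?eb.
- by rewrite numulr0 numul0r.
- by rewrite numulDr numulDl; apply: rangeD; [apply: (IHx a b) | apply: (IHy a b)].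
- have [s [_ sy _]] := supp_exists y; rewrite -sy /usum numul_suml !numul_sumr.
  rewrite numul_suml; apply: range_sum => c _; rewrite -U_sum numul_suml.
  rewrite !numul_sumr numul_suml; apply: range_sum => z zc.
  have -> : u.2 ** (x ** (z.1 ** z.2 ** y)) ** u'.1 =
            (u.2 ** x ** z.1) ** (z.2 ** y ** u'.1) by rewrite !mulgA.
  by apply: rangeM; [apply: (IHx a c) | apply: (IHy c b)].
- have [z _ zE] := IHx _ _ _ _ ua ub; exists (k *: z) => //.
  by rewrite (homZ phiH) zE -nuscaleAr -nuscaleAl.
Qed.

Lemma corner_transfer : subalg_iso (corner K [set: vertex F]) (corner K V).
Proof.
exists phi; split; [split | | |].
- move=> x _; apply/cornerP; have [s [sU sx xs]] := supp_exists x.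
  have phi_s : phi (usum K s) = usum K (map j s).
    by rewrite (hom_sum phiH) /usum big_map; apply: eq_bigr.
  exists (map j s); split.
    by split; rewrite ?(map_inj_uniq j_inj) // -phi_s -(homM phiH) ?sx ?xs.
  by move=> _ /mapP[v _ ->].
- by move=> x y _ _; apply: phi_inj.
- move=> x /cornerP[s [[_ sx xs] sV]].
  suff [y _ <-] : range phi x by exists y => //; apply: corner_setT.
  rewrite -sx -xs /usum numul_suml; apply: range_sum => v vs.
  rewrite !numul_sumr; apply: range_sum => w ws; rewrite mulgA.
  exact: transfer_range (U_V (sV _ vs)) (U_V (sV _ ws)).
- by move=> x y _ _; apply: homD.
- by move=> x y _ _; apply: homM.
- by move=> k x _; apply: homZ.
Qed.

End CornerTransfer.

(** * Collapsing regular vertices *)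

(** Serves to extend the generators of the algebra of a collapse to all vertices
and paths, by 0, and to invert the embedding of a corner. *)
Lemma inj_factor (X Y Z : Type) (f : X -> Y) (g : X -> Z) (z0 : Z) :
  injective f -> exists h : Y -> Z, forall x, h (f x) = g x.
Proof.
move=> f_inj.
exists (fun y => if pselect (exists x, f x = y) is left H
                 then g (projT1 (cid H)) else z0) => x.
case: pselect => [H|[]]; last by exists x.
by congr g; apply: f_inj; apply: projT2 (cid H).
Qed.

(** The edges of the collapse: paths between vertices outside [T] whose inner
vertices lie in [T]. When no edge joins two vertices of [T], they have at most two
edges. *)
Definition return_path (E : graph) (T : pred (vertex E)) (p : seq (edge E)) :=
  match p with
  | [:: e] => ~~ T (src e) && ~~ T (rng e)
  | [:: e; f] => [&& ~~ T (src e), rng e == src f & T (src f)]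
  | _ => false
  end.

(** [F] is the collapse of [T], presented up to isomorphism by the embedding [j]
of its vertices and the path [mu h] that each edge [h] stands for. In this form the
identification of a concrete graph with a collapse includes the isomorphism. *)
Record is_collapse (E : graph) (T : pred (vertex E)) (F : graph)
    (j : vertex F -> vertex E) (mu : edge F -> seq (edge E)) : Prop := {
  col_reg : forall t, T t -> regular t;
  col_indep : forall e, T (src e) -> ~~ T (rng e);
  col_inj : injective j;
  col_jT : forall u, ~~ T (j u);
  col_jTN : forall v, ~~ T v -> exists u, j u = v;
  col_mu_inj : injective mu;
  col_mu_return : forall h, return_path T (mu h);
  col_return_mu : forall p, return_path T p -> exists h, mu h = p;
  col_mu_path : forall h, is_path (j (src h)) (mu h);
  col_mu_rng : forall h, path_range (j (src h)) (mu h) = j (rng h)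
}.

Section Collapse.
Variables (K : fieldType) (E F : graph) (T : pred (vertex E)).
Variables (j : vertex F -> vertex E) (mu : edge F -> seq (edge E)).
Hypothesis col : is_collapse T j mu.

(** A vertex of [T] is regular and all its edges end outside [T], so a single
saturation step suffices. *)
Lemma collapse_full : full_corner [set v | ~~ T v].
Proof.
apply/seteqP; split=> // v _; exists 1%N => //=; case: (boolP (T v)) => Tv.
  right; split; first exact: (col_reg col).
  move=> _ [e ev <-]; exists (rng e), [::]; split=> //=.
  by apply: (col_indep col); rewrite ev.
by left; exists v, [::]; split.
Qed.

Lemma setT_full : full_corner [set: vertex F].
Proof. by apply/seteqP; split=> // v _; exists 0%N => //; exists v, [::]. Qed.

Lemma outs_exists : exists outs : vertex E -> seq (edge E),
  forall v, T v -> uniq (outs v) /\ (forall e, (e \in outs v) = (src e == v)).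
Proof.
suff /choice[outs outsP] : forall v, exists l : seq (edge E), T v ->
    uniq l /\ (forall e, (e \in l) = (src e == v)) by exists outs.
move=> v; case: (boolP (T v)) => Tv; last by exists [::].
have [l lU lE] := out_edges_list (col_reg col Tv); exists l => _; split=> //.
exact: mem_out_list.
Qed.

Let outs := projT1 (cid outs_exists).
Let outs_uniq v : T v -> uniq (outs v).
Proof. by move=> Tv; have [] := projT2 (cid outs_exists) v Tv. Qed.
Let outsE v e : T v -> (e \in outs v) = (src e == v).
Proof. by move=> Tv; have [_ ->] := projT2 (cid outs_exists) v Tv. Qed.

(** The shortest paths from [v] to the complement of [T]. They index a partition
of the idempotent [v] ([tails_sum], [tails_orth]), hence the rows and columns of
the matrices over L(F) below. *)
Definition tails v : seq (seq (edge E)) :=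
  if T v then [seq [:: f] | f <- outs v] else [:: [::]].

Lemma tails_uniq v : uniq (tails v).
Proof.
rewrite /tails; case: ifP => // Tv.
by rewrite map_inj_uniq ?outs_uniq // => e f [].
Qed.

Lemma nil_tails v : ([::] \in tails v) = ~~ T v.
Proof.
rewrite /tails; case: ifP => // Tv.
by apply/negbTE/negP => /mapP[].
Qed.

Lemma seq1_tails v f : ([:: f] \in tails v) = T v && (src f == v).
Proof.
rewrite /tails; case: ifP => Tv; last by rewrite inE.
by rewrite mem_map ?outsE // => e e' [].
Qed.

Lemma tailsN v : ~~ T v -> tails v = [:: [::]].
Proof. by rewrite /tails => /negPf->. Qed.

Variant tails_spec v : seq (edge E) -> Prop :=
| TailsNil of ~~ T v : tails_spec v [::]
| TailsCons f of T v & src f = v & ~~ T (rng f) : tails_spec v [:: f].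

Lemma tailsP v y : y \in tails v -> tails_spec v y.
Proof.
case: y => [|f [|g y]].
- by rewrite nil_tails; constructor.
- rewrite seq1_tails => /andP[Tv /eqP fv]; constructor => //.
  by apply: (col_indep col); rewrite fv.
- by rewrite /tails; case: ifP => // _ /mapP[].
Qed.

Lemma tails_path v y : y \in tails v -> is_path v y.
Proof. by case/tailsP. Qed.

Lemma tails_rng v y : y \in tails v -> ~~ T (path_range v y).
Proof. by case/tailsP. Qed.

Lemma tails_nonempty v : exists y, y \in tails v.
Proof.
case: (boolP (T v)) => Tv; last by exists [::]; rewrite nil_tails.
have [[e ev] _] := col_reg col Tv; exists [:: e]; rewrite seq1_tails Tv.
exact/eqP.
Qed.

Lemma return_pathP p : return_path T p <->
  exists e y, [/\ p = e :: y, ~~ T (src e) & y \in tails (rng e)].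
Proof.
split=> [|[e [y [-> Te]]]].
  case: p => [|e [|f [|g p]]] //= => [/andP[Te Tr]|/and3P[Te /eqP ef Tf]].
    by exists e, [::]; rewrite nil_tails.
  by exists e, [:: f]; rewrite seq1_tails ef Tf eqxx.
by case/tailsP => [Tr|f Tf fe _] /=; rewrite ?Te ?Tr // fe eqxx Tf.
Qed.

Lemma return_lift e y : ~~ T (src e) -> y \in tails (rng e) ->
  exists h, [/\ mu h = e :: y, j (src h) = src e &
                j (rng h) = path_range (rng e) y].
Proof.
move=> Te ye; have [|h hE] := col_return_mu col (p := e :: y).
  by apply/return_pathP; exists e, y.
have := col_mu_path col h; have := col_mu_rng col h; rewrite hE => hr [hs _].
by exists h; split.
Qed.

Lemma mu_split h : exists e y, [/\ mu h = e :: y, j (src h) = src e,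
  ~~ T (src e), y \in tails (rng e) & j (rng h) = path_range (rng e) y].
Proof.
have /return_pathP[e [y [hE Te ye]]] := col_mu_return col h.
have := col_mu_path col h; have := col_mu_rng col h; rewrite hE => hr [hs _].
by exists e, y.
Qed.

Definition returns (l : seq (edge E)) :=
  [seq e :: y | e <- l, y <- tails (rng e)].

Lemma perm_returns v (lF : seq (edge F)) (l : seq (edge E)) :
    uniq lF -> [set` lF] = out_edges v ->
    uniq l -> [set` l] = out_edges (j v) ->
  perm_eq (map mu lF) (returns l).
Proof.
move=> lFU lFE lU lE.
have inl := mem_out_list lE; have inlF := mem_out_list lFE.
apply: uniq_perm.
- by rewrite (map_inj_uniq (col_mu_inj col)).
- by apply: allpairs_uniq_dep => //= [e _|[e y] [e' y'] _ _ /= [-> ->]//];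
    exact: tails_uniq.
- move=> p; apply/mapP/allpairsPdep => [[h hl ->]|[e [y [el ye ->]]]].
    have [e [y [-> hs Te ye _]]] := mu_split h; exists e, y; split=> //.
    by rewrite inl -hs; move: hl; rewrite inlF => /eqP->.
  move: el; rewrite inl => /eqP es.
  have [|h [hE hs _]] := return_lift (e := e) (y := y) _ ye.
    by rewrite es; apply: (col_jT col).
  exists h => //; rewrite inlF; apply/eqP/(col_inj col).
  by rewrite hs es.
Qed.

(** Each edge of [E] starting outside [T] is the first edge of at least one and
of finitely many return paths, because the vertices of [T] are regular. *)
Lemma collapse_regular v : regular (j v) <-> regular v.
Proof.
split=> [reg|[[h hv] vfin]].
  have [l lU lE] := out_edges_list reg.
  have [k kP] := inj_factor Some None (col_mu_inj col).
  have [[e es] _] := reg; have [y ye] := tails_nonempty (rng e).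
  split.
    have [|h [_ hs _]] := return_lift (e := e) (y := y) _ ye.
      by rewrite es; apply: (col_jT col).
    by exists h; apply: (col_inj col); rewrite hs.
  apply: (@sub_finite_set _ _ [set` pmap k (returns l)]); last first.
    by apply: finite_seq.
  move=> h /= hv; rewrite mem_pmap; apply/mapP; exists (mu h); rewrite ?kP //.
  have [e' [y' [-> hs _ ye' _]]] := mu_split h.
  apply/allpairsPdep; exists e', y'; split=> //.
  have : out_edges (j v) e' by rewrite /out_edges /= -hs hv.
  by rewrite -lE.
split.
  have [e [y [_ hs _ _ _]]] := mu_split h.
  by exists e; rewrite /out_edges /= -hs hv.
have /finite_seqP[lF lFE] := vfin.
apply: (@sub_finite_set _ _ [set` pmap (ohead \o mu) lF]); last first.
  by apply: finite_seq.
move=> e /= es; have [y ye] := tails_nonempty (rng e).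
have [|h' [hE hs _]] := return_lift (e := e) (y := y) _ ye.
  by rewrite es; apply: (col_jT col).
rewrite mem_pmap; apply/mapP; exists h'; rewrite /= ?hE //.
have : out_edges v h' by apply: (col_inj col); rewrite hs.
by rewrite lFE.
Qed.

Local Notation lvE := (lvertex K (E := E)).
Local Notation leE := (ledge K (E := E)).
Local Notation lgE := (lghost K (E := E)).
Local Notation lvF := (lvertex K (E := F)).
Local Notation leF := (ledge K (E := F)).
Local Notation lgF := (lghost K (E := F)).

Let famE := leavitt_is_family K E.
Let famF := leavitt_is_family K F.

Lemma tails_sum v : \sum_(y <- tails v) lpath K v y ** gpath K v y = lvE v.
Proof.
rewrite /tails; case: ifPn => Tv; last by rewrite big_seq1 /= (lf_idem famE).
rewrite big_map (lf_CK2 famE (col_reg col Tv) (outs_uniq Tv)); last first.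
  by apply/seteqP; split=> e /=; rewrite outsE // => /eqP.
by apply: eq_bigr => f _ /=; rewrite (lf_rng famE) (lf_ghost_rng famE).
Qed.

Lemma tails_orth v y y' : y \in tails v -> y' \in tails v -> y <> y' ->
  gpath K v y ** lpath K v y' = 0.
Proof.
case/tailsP => [Tv|f Tv fv _].
  by case/tailsP => [//|f' Tf']; rewrite Tf' in Tv.
case/tailsP => [Tv'|f' _ f'v _ ff' /=]; first by rewrite Tv in Tv'.
rewrite mulgA -(mulgA _ (lgE f)) (lf_CK1_orth famE) ?numulr0 ?numul0r //.
by move=> ee; apply: ff'; rewrite ee.
Qed.

(** An edge of the collapse is sent to the product of the edges of its path. The
second Cuntz-Krieger relation at [v] in [F] is the one at [v] in [E], expanded at
the ranges that lie in [T]. *)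
Lemma collapse_family :
  leavitt_family (fun v => lvE (j v))
    (fun h => lpath K (j (src h)) (mu h)) (fun h => gpath K (j (src h)) (mu h)).
Proof.
split.
- by move=> v; apply: (lf_idem famE).
- by move=> v w vw; apply: (lf_orth famE) => /(col_inj col).
- by move=> h; apply/lpath_src/(col_mu_path col).
- by move=> h; rewrite -(col_mu_rng col) lpath_rng.
- by move=> h; rewrite -(col_mu_rng col) gpath_rng.
- by move=> h; apply/gpath_src/(col_mu_path col).
- by move=> h; rewrite gpath_lpath ?(col_mu_rng col) //; apply: (col_mu_path col).
- move=> h h' hh'.
  have [e [y [hE _ Te ye _]]] := mu_split h.
  have [e' [y' [h'E _ Te' ye' _]]] := mu_split h'.
  rewrite hE h'E /= mulgA -(mulgA _ (lgE e)).
  case: (eqVneq e e') => [ee'|/eqP ee']; last first.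
    by rewrite (lf_CK1_orth famE) ?numulr0 ?numul0r.
  subst e'; rewrite (lf_CK1 famE) -mulgA (lpath_src _ (tails_path ye')).
  apply: tails_orth => // yy'; apply: hh'; apply: (col_mu_inj col).
  by rewrite hE h'E yy'.
- move=> v l vreg lU lEv.
  have jreg : regular (j v) by apply/collapse_regular.
  have [l' l'U l'E] := out_edges_list jreg.
  rewrite (lf_CK2 famE jreg l'U l'E).
  have -> : \sum_(e <- l) lpath K (j (src e)) (mu e) ** gpath K (j (src e)) (mu e)
     = \sum_(p <- map mu l) lpath K (j v) p ** gpath K (j v) p.
    rewrite big_map big_seq [RHS]big_seq; apply: eq_bigr => h hl.
    by have : [set` l] h by []; rewrite lEv => <-.
  rewrite (perm_big _ (perm_returns lU lEv l'U l'E)) /= big_allpairs_dep /=.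
  apply: eq_bigr => e _.
  rewrite -{1}(lf_rng famE) -tails_sum numul_sumr numul_suml.
  by apply: eq_bigr => y _; rewrite !mulgA.
Qed.

Local Notation Y := (seq (edge E)).
Local Notation B := (leavitt K F).

(** The representation of L(E) on column vectors over L(F) indexed by paths. A
vertex acts diagonally on its tails. An edge from outside [T] acts as a row, since
followed by a tail it is a return path; an edge [e] from a vertex of [T] is itself a
tail, and acts as a change of index between [[:: e]] and the empty tail. The
functions [bv], [bp] and [bq] extend the generators of L(F) by 0. *)
Section Representation.
Variables (bv : vertex E -> B) (bp bq : seq (edge E) -> B).
Hypothesis bvP : forall u, bv (j u) = lvF u.
Hypothesis bpP : forall h, bp (mu h) = leF h.
Hypothesis bqP : forall h, bq (mu h) = lgF h.

Definition rep_v v : endo (Y -> B) :=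
  \sum_(y <- tails v) emx y (bv (path_range v y)) y.
Definition rep_e e : endo (Y -> B) :=
  if T (src e) then emx [:: e] (bv (rng e)) [::]
  else \sum_(y <- tails (rng e)) emx [::] (bp (e :: y)) y.
Definition rep_g e : endo (Y -> B) :=
  if T (src e) then emx [::] (bv (rng e)) [:: e]
  else \sum_(y <- tails (rng e)) emx y (bq (e :: y)) [::].

Lemma bv_idem v : ~~ T v -> bv v ** bv v = bv v.
Proof. by case/(col_jTN col) => u <-; rewrite bvP (lf_idem famF). Qed.

Lemma rep_vN v : ~~ T v -> rep_v v = emx [::] (bv v) [::].
Proof. by move=> Tv; rewrite /rep_v tailsN // big_seq1. Qed.

Lemma rep_regular e y : ~~ T (src e) -> y \in tails (rng e) ->
  [/\ bv (src e) ** bp (e :: y) = bp (e :: y),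
      bp (e :: y) ** bv (path_range (rng e) y) = bp (e :: y),
      bq (e :: y) ** bv (src e) = bq (e :: y)
    & bv (path_range (rng e) y) ** bq (e :: y) = bq (e :: y) ].
Proof.
move=> Te ye; have [h [<- <- <-]] := return_lift Te ye.
rewrite !bvP bpP bqP.
by rewrite (lf_src famF) (lf_rng famF) (lf_ghost_rng famF) (lf_ghost_src famF).
Qed.

Lemma rep_CK e y e' y' : ~~ T (src e) -> y \in tails (rng e) ->
    ~~ T (src e') -> y' \in tails (rng e') ->
  bq (e :: y) ** bp (e' :: y') =
    if e :: y == e' :: y' then bv (path_range (rng e) y) else 0.
Proof.
move=> Te ye Te' ye'; have [h [hE _ hr]] := return_lift Te ye.
have [h' [h'E _ _]] := return_lift Te' ye'.
rewrite -hE -h'E bpP bqP -hr bvP (inj_eq (col_mu_inj col)).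
by case: eqP => [->|/(lf_CK1_orth famF)//]; rewrite (lf_CK1 famF).
Qed.

Lemma tails_src e : T (src e) -> [:: e] \in tails (src e).
Proof. by move=> Te; rewrite seq1_tails Te eqxx. Qed.

Lemma rep_family : leavitt_family rep_v rep_e rep_g.
Proof.
have idem v : rep_v v ** rep_v v = rep_v v.
  rewrite {1}/rep_v numul_suml /rep_v [LHS]big_seq [RHS]big_seq.
  apply: eq_bigr => y yv; rewrite (emx_sumr id) ?tails_uniq //.
  by rewrite bv_idem // tails_rng.
split=> //.
- move=> v w vw; rewrite /rep_v numul_suml big1_seq // => y /= yv.
  rewrite numul_sumr big1_seq // => z /= zw.
  case: (eqVneq y z) => [yz|]; last exact: emxM0.
  subst z; rewrite emxM; move: yv zw.
  case/tailsP => [Tv|f _ fv _]; last by rewrite seq1_tails fv => /andP[_ /eqP].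
  rewrite nil_tails => Tw; rewrite /path_range /=.
  have [v' v'E] := col_jTN col Tv; have [w' w'E] := col_jTN col Tw.
  rewrite -v'E -w'E !bvP (lf_orth famF) ?emx0 // => v'w'.
  by apply: vw; rewrite -v'E -w'E v'w'.
- move=> e; rewrite /rep_e; case: ifPn => Te.
    rewrite /rep_v (emx_suml id) ?tails_uniq ?tails_src // /path_range /=.
    by rewrite bv_idem // (col_indep col).
  rewrite rep_vN // numul_sumr big_seq [RHS]big_seq; apply: eq_bigr => y ye.
  by rewrite emxM; have [->] := rep_regular Te ye.
- move=> e; rewrite /rep_e; case: ifPn => Te.
    by rewrite rep_vN ?emxM ?bv_idem ?(col_indep col).
  rewrite /rep_v (emx_sumM (fun=> [::]) id) ?tails_uniq // big_seq [RHS]big_seq.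
  by apply: eq_bigr => y ye; have [_ ->] := rep_regular Te ye.
- move=> e; rewrite /rep_g; case: ifPn => Te.
    by rewrite rep_vN ?emxM ?bv_idem ?(col_indep col).
  rewrite /rep_v (emx_sumM id (fun=> [::])) ?tails_uniq // big_seq [RHS]big_seq.
  by apply: eq_bigr => y ye; have [_ _ _ ->] := rep_regular Te ye.
- move=> e; rewrite /rep_g; case: ifPn => Te.
    rewrite /rep_v (emx_sumr id) ?tails_uniq ?tails_src // /path_range /=.
    by rewrite bv_idem // (col_indep col).
  rewrite rep_vN // numul_suml big_seq [RHS]big_seq; apply: eq_bigr => y ye.
  by rewrite emxM; have [_ _ ->] := rep_regular Te ye.
- move=> e; rewrite /rep_g /rep_e; case: ifPn => Te.
    by rewrite rep_vN ?emxM ?bv_idem ?(col_indep col).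
  rewrite numul_suml /rep_v big_seq [RHS]big_seq; apply: eq_bigr => y ye.
  rewrite numul_sumr (bigD1_seq y) ?tails_uniq //= emxM rep_CK // eqxx.
  rewrite big_seq_cond big1 ?addr0 // => y' /andP[ye' y'y].
  rewrite emxM rep_CK // eqseq_cons eqxx /= eq_sym (negPf y'y).
  by rewrite emx0.
- move=> e f ef; rewrite /rep_g /rep_e; case: ifPn => Te; case: ifPn => Tf.
  + by rewrite emxM0 // eqseq_cons andbT; apply/eqP.
  + by rewrite numul_sumr big1 // => y _; rewrite emxM0.
  + by rewrite numul_suml big1 // => y _; rewrite emxM0.
  + rewrite numul_suml big1_seq // => y /= ye.
    rewrite numul_sumr big1_seq // => z /= zf.
    by rewrite emxM rep_CK // eqseq_cons (negPf (introN eqP ef)) emx0.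
- move=> v l vreg lU lEv; case: (boolP (T v)) => Tv.
    rewrite /rep_v /tails Tv big_map.
    have vl : perm_eq (outs v) l.
      apply: uniq_perm => //; first exact: outs_uniq.
      move=> e; rewrite outsE //; apply/eqP/idP => [ev|el].
        by have : out_edges v e by []; rewrite -lEv.
      by have : [set` l] e by []; rewrite lEv.
    rewrite (perm_big _ vl) /= big_seq [RHS]big_seq; apply: eq_bigr => e el.
    have ev : src e = v by have : [set` l] e by []; rewrite lEv.
    by rewrite /rep_e /rep_g ev Tv emxM bv_idem // (col_indep col) // ev.
  have [u uv] := col_jTN col Tv; rewrite rep_vN //; subst v.
  have ureg : regular u by apply/collapse_regular.
  have [lF' lFU lFE] := out_edges_list ureg.
  rewrite bvP (lf_CK2 famF ureg lFU lFE).
  have -> : \sum_(h <- lF') leF h ** lgF h =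
            \sum_(p <- map mu lF') bp p ** bq p.
    by rewrite big_map; apply: eq_bigr => h _; rewrite bpP bqP.
  rewrite (perm_big _ (perm_returns lFU lFE lU lEv)) /= big_allpairs_dep /=.
  rewrite emx_sum big_seq [RHS]big_seq; apply: eq_bigr => e el.
  have eu : src e = j u by have : [set` l] e by []; rewrite lEv.
  by rewrite /rep_e /rep_g eu (negPf Tv) (emx_sumM (fun=> [::]) (fun=> [::]))
    -?emx_sum ?tails_uniq.
Qed.

End Representation.

(** The composite with the representation is [b |-> emx [::] b [::]], which is
injective because L(F) has local units. *)
Lemma collapse_hom_inj (phi : leavitt K F -> leavitt K E) :
    nualg_hom phi -> (forall v, phi (lvF v) = lvE (j v)) ->
    (forall h, phi (leF h) = lpath K (j (src h)) (mu h)) ->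
    (forall h, phi (lgF h) = gpath K (j (src h)) (mu h)) ->
  injective phi.
Proof.
move=> phiH phiv phie phig.
have [bv bvP] := inj_factor lvF 0 (col_inj col).
have [bp bpP] := inj_factor leF 0 (col_mu_inj col).
have [bq bqP] := inj_factor lgF 0 (col_mu_inj col).
have [rho [rhoH rhov rhoe rhog]] := leavitt_lift (rep_family bvP bpP bqP).
have key : rho \o phi =1 (fun b => emx [::] b [::]).
  apply: leavitt_hom_ext => [||v|h|h] /=.
  - exact: hom_comp.
  - exact: emx_hom.
  - by rewrite phiv rhov rep_vN ?bvP ?(col_jT col).
  - rewrite phie; have [e [y [hE hs Te ye hr]]] := mu_split h.
    rewrite hE /= (homM rhoH) rhoe /rep_e (negPf Te).
    case/tailsP: ye hE hr => [Tr|f Tf fE Tr] hE hr.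
      rewrite tailsN //= big_seq1 rhov rep_vN // emxM -hE bpP.
      by rewrite -[rng e]hr bvP (lf_rng famF).
    rewrite /= (lf_rng famE) rhoe /rep_e fE Tf.
    rewrite (emx_suml (fun=> [::])) ?tails_uniq ?seq1_tails ?Tf ?fE ?eqxx //.
    by rewrite -hE bpP -[rng f]hr bvP (lf_rng famF).
  - rewrite phig; have [e [y [hE hs Te ye hr]]] := mu_split h.
    rewrite hE /= (homM rhoH) rhog /rep_g (negPf Te).
    case/tailsP: ye hE hr => [Tr|f Tf fE Tr] hE hr.
      rewrite tailsN //= big_seq1 rhov rep_vN // emxM -hE bqP.
      by rewrite -[rng e]hr bvP (lf_ghost_rng famF).
    rewrite /= (lf_ghost_rng famE) rhog /rep_g fE Tf.
    rewrite (emx_sumr (fun=> [::])) ?tails_uniq ?seq1_tails ?Tf ?fE ?eqxx //.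
    by rewrite -hE bqP -[rng f]hr bvP (lf_ghost_rng famF).
move=> x y xy; have [s [_ xs _]] := supp_exists (x - y).
suff xy0 (g : B) : (x - y) ** g = 0.
  have [t [_ _ tx]] := supp_exists (x - y).
  by apply/eqP; rewrite -subr_eq0 -tx xy0.
have := congr1 (fun z => val (rho z) (fun _ => g) [::]) xy.
rewrite -[rho (phi x)]/((rho \o phi) x) -[rho (phi y)]/((rho \o phi) y) !key !emxE.
by rewrite eqxx numulBl => ->; rewrite subrr.
Qed.

(** The connecting pairs are the tails and their adjoints. For an edge [e] from a
vertex of [T], which is a tail, [u^* e] is a vertex or zero; for an edge [e] from
outside [T], [e u'] is a return path. *)
Lemma collapse_corner_iso :
  subalg_iso (corner K [set: vertex F]) (corner K [set v | ~~ T v]).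
Proof.
have [phi [phiH phiv phie phig]] := leavitt_lift collapse_family.
have lift_e e y : ~~ T (src e) -> y \in tails (rng e) ->
    range phi (leE e ** lpath K (rng e) y).
  move=> Te ye; have [h [hE _ _]] := return_lift Te ye.
  by exists (leF h); rewrite // phie hE.
have lift_g e y : ~~ T (src e) -> y \in tails (rng e) ->
    range phi (gpath K (rng e) y ** lgE e).
  move=> Te ye; have [h [hE _ _]] := return_lift Te ye.
  by exists (lgF h); rewrite // phig hE.
have lift_v v : ~~ T v -> range phi (lvE v).
  by move=> /(col_jTN col)[u <-]; exists (lvF u); rewrite ?phiv.
have lift0 : range phi 0 by exists 0; rewrite ?(hom0 phiH).
pose U v := [seq (lpath K v y, gpath K v y) | y <- tails v].
apply: (@corner_transfer K E F _ j phi phiH _ (col_inj col) _ phiv U).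
- exact: collapse_hom_inj phiH phiv phie phig.
- exact: (col_jT col).
- by move=> v; rewrite /U big_map /= tails_sum.
- by move=> v Tv; rewrite /U tailsN //= inE.
- by move=> v u /mapP[y yv ->]; apply/lpath_src/tails_path.
- by move=> v u /mapP[y yv ->]; apply/gpath_src/tails_path.
- move=> v _ _ /mapP[y yv ->] /mapP[z zv ->]; rewrite [(_, _).1]/= [(_, _).2]/=.
  case: (eqVneq y z) => [yz|/eqP yz]; last by rewrite tails_orth.
  subst z; rewrite gpath_lpath; last exact: tails_path.
  exact: lift_v (tails_rng yv).
- move=> e _ _ /mapP[y ye ->] /mapP[z ze ->]; rewrite [(_, _).1]/= [(_, _).2]/=.
  case: (boolP (T (src e))) => Te; last first.
    move: ye; rewrite tailsN // inE => /eqP->.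
    by rewrite [gpath _ _ [::]]/= (lf_src famE); apply: lift_e.
  move: ze; rewrite tailsN ?(col_indep col) // inE => /eqP->; rewrite [lpath _ _ [::]]/=.
  rewrite -mulgA (lf_rng famE) -[leE e](lf_rng famE).
  change (range phi (gpath K (src e) y ** lpath K (src e) [:: e])).
  case: (eqVneq y [:: e]) => [yE|/eqP yE]; last by rewrite tails_orth ?tails_src.
  subst y; rewrite gpath_lpath //.
  by exact: (lift_v _ (col_indep col Te)).
- move=> e _ _ /mapP[y ye ->] /mapP[z ze ->]; rewrite [(_, _).1]/= [(_, _).2]/=.
  case: (boolP (T (src e))) => Te; last first.
    move: ze; rewrite tailsN // inE => /eqP->; rewrite [lpath _ _ [::]]/=.
    by rewrite -mulgA (lf_ghost_src famE); apply: lift_g.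
  move: ye; rewrite tailsN ?(col_indep col) // inE => /eqP->.
  change (range phi (gpath K (src e) [:: e] ** lpath K (src e) z)).
  case: (eqVneq z [:: e]) => [zE|/eqP zE].
    by subst z; rewrite gpath_lpath //; exact: (lift_v _ (col_indep col Te)).
  by rewrite tails_orth ?tails_src // => ez; apply: zE.
Qed.

End Collapse.

(** * The moves that are collapses *)

Lemma graph_iso_collapse (E F : graph) : graph_iso E F ->
  exists j mu, @is_collapse F pred0 E j mu.
Proof.
move=> [f0 [f1 [f0B f1B f0s f0r]]]; exists f0, (fun e => [:: f1 e]).
split=> //=.
- exact: bij_inj.
- by move=> v _; case: f0B => g gK Kg; exists (g v).
- by move=> e e' [] /(bij_inj f1B).
- case=> [|h [|h' [|h'' p]]] //=; last by rewrite andbF.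
  by move=> _; case: f1B => g gK Kg; exists (g h); rewrite Kg.
Qed.

Lemma moveS_collapse (E : graph) (w : vertex E) (w_source : is_source w) :
    regular w ->
  @is_collapse E (pred1 w) (moveS w_source) val (fun h => [:: val h]).
Proof.
move=> wreg; split=> //=.
- by move=> t /eqP->.
- by move=> e _; apply: moveS_rng_neq.
- exact: val_inj.
- exact: valP.
- by move=> v vw; exists (exist _ v vw).
- by move=> h h' [hh]; apply: val_inj.
- by move=> h; rewrite (valP h) /=; apply: moveS_rng_neq.
- case=> [|e [|f [|g p]]] //=.
    by move=> /andP[ew _]; exists (exist _ e ew).
  move=> /and3P[_ /eqP ef /eqP fw].
  by have := moveS_rng_neq w_source e; rewrite ef fw eqxx.
Qed.

Lemma moveR_collapse (E : graph) (w x : vertex E) (f : edge E)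
    (w_in : (@src E) @` in_edges w = [set x])
    (w_out : out_edges w = [set f]) (f_rng : rng f != w) :
    regular w ->
  @is_collapse E (pred1 w) (moveR w_in w_out f_rng) val
    (fun h => match h with inl e => [:: val e] | inr e => [:: val e; f] end).
Proof.
move=> wreg.
have outw e : (src e == w) = (e == f).
  apply/eqP/eqP => [ew|->].
    by have : out_edges w e by []; rewrite w_out.
  by have : [set f] f by []; rewrite -w_out.
have inw e : rng e = w -> src e = x.
  by move=> ew; have : [set x] (src e) by rewrite -w_in; exists e.
have xw := moveR_x_neq w_in w_out f_rng.
split=> //=.
- by move=> t /eqP->.
- by move=> e; rewrite outw => /eqP->.
- exact: val_inj.
- exact: valP.
- by move=> v vw; exists (exist _ v vw).
- by move=> [h|h] [h'|h'] // [hh]; congr (_ _); apply: val_inj.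
- move=> [[e /= /andP[ef er]]|[e /= /eqP er]].
    by rewrite outw ef er.
  by rewrite er outw (_ : src f = w) ?eqxx ?andbT;
    [rewrite -outw (inw _ er) | apply/eqP; rewrite outw].
- case=> [|e [|g [|h p]]] //=.
    move=> /andP[]; rewrite outw => es er.
    have eP : (e != f) && (rng e != w) by rewrite es.
    by exists (inl (exist _ e eP)).
  move=> /and3P[es /eqP er]; rewrite outw => /eqP gf; subst g.
  have fw : src f == w by rewrite outw.
  have eP : rng e == w by rewrite er.
  by exists (inr (exist _ e eP)).
- move=> [[e /= eP]|[e /= /eqP er]] //; split; first exact: inw.
  by split=> //; rewrite er; apply/eqP; rewrite outw.
- by move=> [].
Qed.

(** Every edge that enters [w] is subdivided, the edges of block [i] being led
through a common new vertex [i] and then a single edge to [w]. *)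
Section InDelay.
Variables (E : graph) (w : vertex E) (n : nat) (c : edge E -> 'I_n).

Definition in_delay : graph :=
  @Graph (vertex E + 'I_n)%type (edge E + 'I_n)%type
    (fun h => match h with inl e => inl (src e) | inr i => inr i end)
    (fun h => match h with
              | inl e => if rng e == w then inr (c e) else inl (rng e)
              | inr i => inl w
              end).

Definition is_delay (v : vertex in_delay) : bool :=
  if v is inr _ then true else false.

(** Collapsing the new vertices undoes the subdivision. *)
Lemma in_delay_collapse :
  @is_collapse in_delay is_delay E inl
    (fun e => if rng e == w then [:: inl e; inr (c e)] else [:: inl e]).
Proof.
split=> //=.
- move=> [//|i] _; split; first by exists (inr i).
  apply/finite_seqP; exists [:: inr i]; apply/seteqP; split=> [[e|k]|[e|k]] //=.
    by case=> ->; rewrite inE.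
  by rewrite inE => /eqP[->].
- by case.
- by move=> v v' [].
- by case=> // v _; exists v.
- by move=> e e'; do 2![case: ifP => _] => -[].
- by move=> e; case: ifP => ew /=; rewrite ew ?eqxx.
- case=> [|[e|i] [|[f|k] [|h p]]] //=; rewrite ?andbF //.
  + by move=> ew; exists e; move: ew; case: ifP.
  + by case: ifP => // ew; rewrite andbT => /eqP[<-]; exists e; rewrite ew.
- by move=> e; case: ifP => ew /=; rewrite ?ew.
- by move=> e; rewrite /path_range; case: ifP => ew /=; [rewrite (eqP ew) | rewrite ew].
Qed.

(** Collapsing [w] composes the edge from each new vertex [i] to [w] with the
edges that leave [w]: these are the [n] copies of the out-edges of [w], and the new
vertices become the copies of [w]. *)
Lemma moveI_collapse : regular w ->
  @is_collapse in_delay (fun v => v == inl w) (moveI w c)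
    (fun v => match v with inl u => inl (val u) | inr i => inr i end)
    (fun h => match h with
              | inl e => [:: inl (val e)]
              | inr (e, i) => [:: inr i; inl (val e)]
              end).
Proof.
move=> [[e0 e0w] /finite_seqP[l lE]]; split=> //=.
- move=> t /eqP->; split; first by exists (inl e0); rewrite /out_edges /= e0w.
  apply/finite_seqP; exists (map inl l); apply/seteqP; split=> [[e|k]|[e|k]] //=.
  + case=> ew; apply/map_f; have : out_edges w e by [].
    by rewrite lE.
  + move=> /mapP[e' e'l [->]]; congr inl.
    by have : [set` l] e' by []; rewrite -lE.
  + by move=> /mapP[].
- case=> // e _; case: ifP => ew; apply/eqP => // -[er].
  by rewrite er eqxx in ew.
- by move=> [u|i] [u'|i'] // [uu]; congr (_ _) => //; apply: val_inj.
- by move=> [[u uw]|i].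
- move=> [v vw|i _]; last by exists (inr i).
  by exists (inl (exist _ v vw)).
- by move=> [e|[e i]] [e'|[e' i']] // => [[ee]|[-> ee]]; congr (_ _);
    [|congr (_, _)]; apply: val_inj.
- move=> [[e /= ew]|[[e /= /eqP ew] i]] //=.
    apply/andP; split; first exact: ew.
    case: ifP => er; apply/eqP => // -[er'].
    by rewrite er' eqxx in er.
  by rewrite ew !eqxx.
- case=> [|[e|i] [|[f|k] [|h p]]] //=; rewrite ?eqxx ?andbF //.
  + by move=> /andP[ew _]; exists (inl (exist (fun e => src e != w) e ew)).
  + case: ifP => ew /and3P[_ /eqP er /eqP fw] //.
    by case: er fw => er [fw]; rewrite er fw eqxx in ew.
  + move=> /andP[_ fw].
    by exists (inr (exist (fun e => src e == w) f fw, i)).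
- by move=> [[e /= ew]|[[e /= /eqP ew] i]] //=; rewrite ew.
- move=> [[e /= ew]|[[e /= /eqP ew] i]] //=; rewrite /path_range /vertex_copy /=.
    case: insubP => [u uw ur|/negPn ->] //.
    by rewrite (negPf uw) -ur.
  case: insubP => [u uw ur|/negPn ->] //.
  by rewrite (negPf uw) -ur.
Qed.

End InDelay.

(** * Out-splitting *)

Section OutSplit.
Variables (K : fieldType) (E : graph) (w : vertex E) (n : nat).
Variable c : edge E -> 'I_n.
Hypothesis w_nsink : ~ is_sink w.
Hypothesis c_blocks : Defs.indexed_partition (out_edges w) c.
Hypothesis c_inf : forall i j,
  infinite_set (out_edges w `&` c @^-1` [set i]) ->
  infinite_set (out_edges w `&` c @^-1` [set j]) -> i = j.

Let F := moveO w c.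

Local Notation lvE := (lvertex K (E := E)).
Local Notation leE := (ledge K (E := E)).
Local Notation lgE := (lghost K (E := E)).
Local Notation lvF := (lvertex K (E := F)).
Local Notation leF := (ledge K (E := F)).
Local Notation lgF := (lghost K (E := F)).

Let famE := leavitt_is_family K E.
Let famF := leavitt_is_family K F.

(** A vertex or an edge of the out-splitting is a copy of its base; the lists
[vcopies] and [ecopies] are the fibres of these maps. *)
Definition base_v (a : vertex F) : vertex E :=
  match a with inl u => val u | inr _ => w end.

Definition base_e (h : edge F) : edge E :=
  match h with inl e => val e | inr (e, _) => val e end.

Definition vcopies (v : vertex E) : seq (vertex F) :=
  if insub v is Some u then [:: inl u] else [seq inr i | i <- enum 'I_n].

Definition ecopies (e : edge E) : seq (edge F) :=
  match insub e : option {e : edge E | rng e != w},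
        insub e : option {e : edge E | rng e == w} with
  | Some u, _ => [:: inl u]
  | _, Some u => [seq inr (u, i) | i <- enum 'I_n]
  | _, _ => [::]
  end.

(** All copies of an edge have the same source, determined by its source and its
block; their ranges run once through the copies of its range. *)
Definition osrc (e : edge E) : vertex F := vertex_copy w (src e) (c e).

Lemma mem_vcopies v a : (a \in vcopies v) = (base_v a == v).
Proof.
rewrite /vcopies; case: insubP => [u uw <-|/negPn/eqP->]; case: a => [u'|i] /=.
- by rewrite inE; apply/eqP/eqP => [[->//]|uu]; congr inl; apply: val_inj.
- by rewrite inE; apply/esym/negbTE; rewrite eq_sym; exact: (valP u).
- rewrite (negPf (valP u')); apply/negbTE/negP.
  by move=> /mapP[].
- by rewrite eqxx; apply/mapP; exists i; rewrite ?mem_enum.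
Qed.

Lemma vcopies_uniq v : uniq (vcopies v).
Proof.
rewrite /vcopies; case: insubP => // _.
by rewrite map_inj_uniq ?enum_uniq // => i j [].
Qed.

Lemma mem_ecopies e h : (h \in ecopies e) = (base_e h == e).
Proof.
rewrite /ecopies; case: insubP => [u uw <-|/negPn ew].
  case: h => [u'|[u' i]] /=.
    by rewrite inE; apply/eqP/eqP => [[->//]|uu]; congr inl; apply: val_inj.
  rewrite inE; apply/esym/negbTE/eqP => uu.
  by have := valP u; rewrite /= -uu (valP u').
case: insubP => [u uw ue|]; last by rewrite ew.
case: h => [u'|[u' i]] /=.
  have ue' : val u' != e by apply/eqP => uu; have := valP u'; rewrite /= uu ew.
  by rewrite (negPf ue'); apply/negbTE/negP => /mapP[].
rewrite -ue; apply/mapP/eqP => [[k _ [->]]//|uu].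
by exists i; rewrite ?mem_enum //; congr (inr (_, _)); apply: val_inj.
Qed.

Lemma ecopies_uniq e : uniq (ecopies e).
Proof.
rewrite /ecopies; case: insubP => // _; case: insubP => // u _ _.
by rewrite map_inj_uniq ?enum_uniq // => i j [].
Qed.

Lemma map_rng_ecopies e : [seq rng h | h <- ecopies e] = vcopies (rng e).
Proof.
rewrite /ecopies /vcopies; case: insubP => [u uw ue|/negPn ew].
  case: insubP => [u' _ ue'|]; last by rewrite uw.
  by congr [:: inl _]; apply: val_inj; rewrite /= ue ue'.
case: insubP => [u _ _|]; last by rewrite ew.
case: insubP => [u' uw _|_]; first by rewrite ew in uw.
by rewrite -map_comp.
Qed.

Lemma src_base h : src h = osrc (base_e h).
Proof. by case: h => [e|[e i]]. Qed.

Lemma out_osrc a h : out_edges a h = (osrc (base_e h) = a).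
Proof. by rewrite -src_base. Qed.

Lemma base_osrc e : base_v (osrc e) = src e.
Proof.
rewrite /osrc /vertex_copy; case: insubP => [u _ //|/negPn/eqP->].
by [].
Qed.

Lemma base_rng h : base_v (rng h) = rng (base_e h).
Proof. by case: h => [e|[e i]] //=; rewrite (eqP (valP e)). Qed.

Lemma rng_ecopies_inj h h' : base_e h = base_e h' -> rng h = rng h' -> h = h'.
Proof.
case: h h' => [e|[e i]] [e'|[e' i']] //= => [ee _|ee [->]].
  by congr inl; apply: val_inj.
by congr (inr (_, _)); apply: val_inj.
Qed.

Lemma sum_vcopies_rng (A : nmodType) e (f : vertex F -> A) :
  \sum_(h <- ecopies e) f (rng h) = \sum_(a <- vcopies (rng e)) f a.
Proof. by rewrite -map_rng_ecopies big_map. Qed.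

Lemma out_copies a (l : seq (edge E)) :
    uniq l -> (forall e, (e \in l) = (osrc e == a)) ->
  uniq (flatten [seq ecopies e | e <- l]) /\
  [set` flatten [seq ecopies e | e <- l]] = out_edges a.
Proof.
move=> lU lE'; split.
  have := @allpairs_uniq_dep _ _ _ (fun _ h => h) l ecopies lU.
  have -> : [seq h | x <- l, h <- ecopies x] = flatten [seq ecopies e | e <- l].
    by congr flatten; apply: eq_map => e; rewrite map_id.
  apply; first by move=> e _; apply: ecopies_uniq.
  move=> [e h] [e' h'] /allpairsPdep[x [y [_ yx [-> ->]]]].
  move=> /allpairsPdep[x' [y' [_ yx' [-> ->]]]] /= yy'; subst y'.
  by move: yx yx'; rewrite !mem_ecopies => /eqP-> /eqP->.
apply/seteqP; split=> h; rewrite out_osrc.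
  move=> /flattenP[_ /mapP[e el ->]]; rewrite mem_ecopies => /eqP he.
  by rewrite he; apply/eqP; rewrite -lE'.
move=> ha; apply/flattenP; exists (ecopies (base_e h)).
  by apply/map_f; rewrite lE' ha.
by rewrite mem_ecopies.
Qed.

Lemma sum_flatten_copies (A : nmodType) (l : seq (edge E)) (f : edge F -> A) :
  \sum_(h <- flatten [seq ecopies e | e <- l]) f h =
  \sum_(e <- l) \sum_(h <- ecopies e) f h.
Proof. by rewrite big_flatten big_map. Qed.

Lemma ecopies_nonempty e : exists h, h \in ecopies e.
Proof.
case: (boolP (rng e == w)) => ew.
  by exists (inr (exist _ e ew, c e)); rewrite mem_ecopies.
by exists (inl (exist _ e ew)); rewrite mem_ecopies.
Qed.

Lemma regular_copy a (l : seq (edge E)) (e0 : edge E) :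
    uniq l -> (forall e, (e \in l) = (osrc e == a)) -> e0 \in l -> regular a.
Proof.
move=> lU lE' e0l; have [U UE] := out_copies lU lE'; split; last first.
  by rewrite -UE; apply: finite_seq.
have [h he] := ecopies_nonempty e0; exists h; rewrite -UE /=.
by apply/flattenP; exists (ecopies e0) => //; apply: map_f.
Qed.

Lemma regular_copy_list a : regular a ->
  exists2 l, uniq l & forall e, (e \in l) = (osrc e == a).
Proof.
move=> [_ /finite_seqP[s sE]]; exists (undup (map base_e s)).
  exact: undup_uniq.
move=> e; rewrite mem_undup; apply/mapP/eqP => [[h hs ->]|ea].
  by rewrite -out_osrc sE.
have [h he] := ecopies_nonempty e; move: he; rewrite mem_ecopies => /eqP he.
exists h => //; have : out_edges a h by rewrite out_osrc he.
by rewrite sE.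
Qed.

(** The map L(E) -> L(F) sends a generator to the sum of its copies. *)

Definition up_v v : leavitt K F := usum K (vcopies v).
Definition up_e e : leavitt K F := \sum_(h <- ecopies e) leF h.
Definition up_g e : leavitt K F := \sum_(h <- ecopies e) lgF h.

(** Mixed products of two copies of one edge vanish since their ranges differ, and
the out-edges of [a] in [F] are the copies of the edges with source copy [a]. *)
Lemma up_CK2_copy a : regular a -> forall l, uniq l ->
  (forall e, (e \in l) = (osrc e == a)) ->
  lvF a = \sum_(e <- l) up_e e ** up_g e.
Proof.
move=> areg l lU lE'; have [U UE] := out_copies lU lE'.
rewrite (lf_CK2 famF areg U UE) sum_flatten_copies; apply: eq_bigr => e _.
rewrite /up_e numul_suml big_seq [RHS]big_seq; apply: eq_bigr => h he.
rewrite /up_g numul_sumr (bigD1_seq h) ?ecopies_uniq //= big_seq_cond big1 ?addr0 //.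
move=> h' /andP[h'e h'h]; rewrite -(lf_rng famF) -(lf_ghost_rng famF h').
rewrite -mulgA (mulgA (lvF _)) (lf_orth famF) ?numul0r ?numulr0 //.
move: he h'e; rewrite !mem_ecopies => /eqP he /eqP h'e rr.
by case/eqP: h'h; apply: rng_ecopies_inj; rewrite ?he.
Qed.

Lemma up_family : leavitt_family up_v up_e up_g.
Proof.
have vU v : supp (vcopies v) (up_v v) by apply/usum_id/vcopies_uniq.
have rngin e h : h \in ecopies e -> rng h \in vcopies (rng e).
  by rewrite mem_ecopies mem_vcopies base_rng => /eqP->.
have srcin e h : h \in ecopies e -> src h \in vcopies (src e).
  by rewrite mem_ecopies mem_vcopies src_base => /eqP->; rewrite base_osrc.
split.
- by move=> v; have [_ ->] := vU v.
- move=> v v' vv'; rewrite /up_v {1}/usum numul_suml big1_seq // => a /= av.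
  rewrite lvertex_usum ?vcopies_uniq // ifN // mem_vcopies.
  by move: av; rewrite mem_vcopies => /eqP->; apply/eqP.
- move=> e; rewrite /up_e numul_sumr big_seq [RHS]big_seq; apply: eq_bigr => h he.
  by rewrite -(lf_src famF) mulgA usum_lvertex ?vcopies_uniq // srcin.
- move=> e; rewrite /up_e numul_suml big_seq [RHS]big_seq; apply: eq_bigr => h he.
  by rewrite -(lf_rng famF) -mulgA lvertex_usum ?vcopies_uniq // rngin.
- move=> e; rewrite /up_g numul_sumr big_seq [RHS]big_seq; apply: eq_bigr => h he.
  by rewrite -(lf_ghost_rng famF) mulgA usum_lvertex ?vcopies_uniq // rngin.
- move=> e; rewrite /up_g numul_suml big_seq [RHS]big_seq; apply: eq_bigr => h he.
  by rewrite -(lf_ghost_src famF) -mulgA lvertex_usum ?vcopies_uniq // srcin.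
- move=> e; rewrite /up_g /up_e /up_v /usum -sum_vcopies_rng numul_suml.
  rewrite big_seq [RHS]big_seq; apply: eq_bigr => h he.
  rewrite numul_sumr (bigD1_seq h) ?ecopies_uniq //= (lf_CK1 famF).
  by rewrite big1 ?addr0 // => h' /eqP hh'; rewrite (lf_CK1_orth famF) // => /esym.
- move=> e f ef; rewrite /up_g numul_suml big1_seq // => h /= he.
  rewrite /up_e numul_sumr big1_seq // => h' /= hf.
  rewrite (lf_CK1_orth famF) // => hh'; apply: ef.
  by move: he hf; rewrite !mem_ecopies hh' => /eqP-> /eqP.
- move=> v l vreg lU lEv.
  have lin := mem_out_list lEv.
  have copyE a : a \in vcopies v ->
      lvF a = \sum_(e <- l | osrc e == a) up_e e ** up_g e.
    rewrite mem_vcopies => /eqP av; rewrite -big_filter.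
    have mem e : (e \in [seq e <- l | osrc e == a]) = (osrc e == a).
      rewrite mem_filter andbC.
      case: (eqVneq (osrc e) a) => [ea|]; last by rewrite andbF.
      by rewrite lin andbT -base_osrc ea av eqxx.
    have [e0 e0a] : exists e0, osrc e0 = a.
      case: a av {mem} => [u|i] /= av.
        have [[e0 e0v] _] := vreg; exists e0; rewrite /osrc /vertex_copy.
        have e0u : src e0 = val u by rewrite e0v -av.
        by rewrite e0u valK.
      have [e0 [e0w <-]] := c_blocks i; exists e0; rewrite /osrc /vertex_copy.
      by rewrite e0w insubF ?eqxx.
    apply: up_CK2_copy; rewrite ?filter_uniq //.
    by apply: (@regular_copy _ _ e0 _ mem); rewrite ?filter_uniq // mem e0a.
  rewrite /up_v /usum (eq_big_seq _ copyE) (exchange_big_dep xpredT) //=.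
  rewrite big_seq [RHS]big_seq; apply: eq_bigr => e el.
  rewrite big_mkcond (bigD1_seq (osrc e)) ?vcopies_uniq //=; last first.
    by rewrite mem_vcopies base_osrc -lin.
  by rewrite eqxx big1 ?addr0 // => a /negPf; rewrite eq_sym => ->.
Qed.

Definition block i : set (edge E) := out_edges w `&` c @^-1` [set i].

(** The list of an infinite block is empty, so that sums over it vanish and the
sum over all lists only counts the finite blocks. *)
Lemma blocks_exist : exists b : 'I_n -> seq (edge E), forall i,
  [/\ uniq (b i),
      finite_set (block i) -> forall e, (e \in b i) = (src e == w) && (c e == i)
    & infinite_set (block i) -> b i = [::]].
Proof.
suff /choice[b bP] : forall i, exists l : seq (edge E),
    [/\ uniq l,
        finite_set (block i) -> forall e, (e \in l) = (src e == w) && (c e == i)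
      & infinite_set (block i) -> l = [::]] by exists b.
move=> i; case: (pselect (finite_set (block i))) => [fin|inf]; last by exists [::].
have /finite_seqP[l lE'] := fin.
exists (undup l); split; rewrite ?undup_uniq // => _ e; rewrite mem_undup.
apply/idP/andP => [el|[/eqP ew /eqP ei]].
  have : [set` l] e by [].
  by rewrite -lE' => -[/= -> ->].
by have : block i e by []; rewrite lE'.
Qed.

Let blk := projT1 (cid blocks_exist).
Let blkP := projT2 (cid blocks_exist).
Let fin i := `[< finite_set (block i) >].

Lemma mem_blk i e : (e \in blk i) = [&& fin i, src e == w & c e == i].
Proof.
have [_ bfin binf] := blkP i; rewrite /fin; case: asboolP => [/bfin->//|/binf].
by rewrite -/(blk i) => ->.
Qed.

Lemma blk_uniq i : uniq (blk i).
Proof. by have [] := blkP i. Qed.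

Lemma fin_unique i k : ~~ fin i -> ~~ fin k -> i = k.
Proof. by move=> /asboolPn i_inf /asboolPn k_inf; apply: c_inf. Qed.

Definition bsum i : leavitt K E := \sum_(e <- blk i) leE e ** lgE e.
Definition btot : leavitt K E := \sum_i bsum i.

Lemma bsum_edge i e : bsum i ** leE e = if e \in blk i then leE e else 0.
Proof.
rewrite /bsum numul_suml; case: ifPn => eb.
  rewrite (bigD1_seq e) ?blk_uniq //= -mulgA (lf_CK1 famE) (lf_rng famE).
  rewrite big1 ?addr0 // => f /eqP fe.
  by rewrite -mulgA (lf_CK1_orth famE) ?numulr0.
rewrite big1_seq // => f /= fb; rewrite -mulgA (lf_CK1_orth famE) ?numulr0 // => fe.
by rewrite -fe fb in eb.
Qed.

Lemma ghost_bsum i e : lgE e ** bsum i = if e \in blk i then lgE e else 0.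
Proof.
rewrite /bsum numul_sumr; case: ifPn => eb.
  rewrite (bigD1_seq e) ?blk_uniq //= mulgA (lf_CK1 famE) (lf_ghost_rng famE).
  rewrite big1 ?addr0 // => f /eqP fe.
  by rewrite mulgA (lf_CK1_orth famE) ?numul0r // => /esym.
rewrite big1_seq // => f /= fb; rewrite mulgA (lf_CK1_orth famE) ?numul0r // => fe.
by rewrite fe fb in eb.
Qed.

Lemma bsumM i k : bsum i ** bsum k = if i == k then bsum i else 0.
Proof.
rewrite {2}/bsum numul_sumr; case: eqVneq => [<-|ik].
  rewrite [RHS]/bsum big_seq [RHS]big_seq.
  by apply: eq_bigr => e eb; rewrite mulgA bsum_edge eb.
rewrite big1_seq // => e /=; rewrite mem_blk => /and3P[_ _ /eqP ek].
by rewrite mulgA bsum_edge mem_blk ek (eq_sym k) (negPf ik) !andbF numul0r.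
Qed.

Lemma lvertex_bsum i : lvE w ** bsum i = bsum i.
Proof.
rewrite /bsum numul_sumr big_seq [RHS]big_seq; apply: eq_bigr => e.
by rewrite mem_blk => /and3P[_ /eqP<- _]; rewrite mulgA (lf_src famE).
Qed.

Lemma bsum_lvertex i : bsum i ** lvE w = bsum i.
Proof.
rewrite /bsum numul_suml big_seq [RHS]big_seq; apply: eq_bigr => e.
by rewrite mem_blk => /and3P[_ /eqP<- _]; rewrite -mulgA (lf_ghost_src famE).
Qed.

Lemma btot_bsum i : btot ** bsum i = bsum i.
Proof.
rewrite /btot numul_suml (bigD1 i) //= bsumM eqxx big1 ?addr0 // => k ki.
by rewrite bsumM (negPf ki).
Qed.

Lemma bsum_btot i : bsum i ** btot = bsum i.
Proof.
rewrite /btot numul_sumr (bigD1 i) //= bsumM eqxx big1 ?addr0 // => k ki.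
by rewrite bsumM eq_sym (negPf ki).
Qed.

Lemma btotM : btot ** btot = btot.
Proof. by rewrite {2 3}/btot numul_sumr; apply: eq_bigr => i _; apply: btot_bsum. Qed.

Lemma lvertex_btot : lvE w ** btot = btot.
Proof. by rewrite /btot numul_sumr; apply: eq_bigr => i _; apply: lvertex_bsum. Qed.

Lemma btot_lvertex : btot ** lvE w = btot.
Proof. by rewrite /btot numul_suml; apply: eq_bigr => i _; apply: bsum_lvertex. Qed.

Lemma btot_edge e :
  btot ** leE e = if (src e == w) && fin (c e) then leE e else 0.
Proof.
rewrite /btot numul_suml; under eq_bigr do rewrite bsum_edge mem_blk.
rewrite (bigD1 (c e)) //= eqxx andbT andbC big1 ?addr0 // => i.
by rewrite eq_sym => /negPf->; rewrite !andbF.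
Qed.

Lemma ghost_btot e :
  lgE e ** btot = if (src e == w) && fin (c e) then lgE e else 0.
Proof.
rewrite /btot numul_sumr; under eq_bigr do rewrite ghost_bsum mem_blk.
rewrite (bigD1 (c e)) //= eqxx andbT andbC big1 ?addr0 // => i.
by rewrite eq_sym => /negPf->; rewrite !andbF.
Qed.

(** The image of [w^i] in L(E). For a finite block it is the sum of the [e e^*]
over the block. The only infinite block takes what the others leave of [w], since
its sum makes no sense; then [w^i] is not regular and no relation constrains it. *)
Definition block_proj i : leavitt K E := if fin i then bsum i else lvE w - btot.

Definition down_v (a : vertex F) : leavitt K E :=
  match a with inl u => lvE (val u) | inr i => block_proj i end.
Definition down_e (h : edge F) : leavitt K E :=
  leE (base_e h) ** down_v (rng h).
Definition down_g (h : edge F) : leavitt K E :=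
  down_v (rng h) ** lgE (base_e h).

Lemma block_projM i k :
  block_proj i ** block_proj k = if i == k then block_proj i else 0.
Proof.
rewrite /block_proj; case: ifPn => fi; case: ifPn => fk.
- exact: bsumM.
- rewrite numulBr bsum_lvertex bsum_btot subrr; case: eqP => // ik.
  by rewrite -ik fi in fk.
- rewrite numulBl lvertex_bsum btot_bsum subrr; case: eqP => // ik.
  by rewrite ik fk in fi.
rewrite (fin_unique fi fk) eqxx numulBl !numulBr (lf_idem famE).
by rewrite lvertex_btot btot_lvertex btotM subrr subr0.
Qed.

Lemma lvertex_down a : lvE (base_v a) ** down_v a = down_v a.
Proof.
case: a => [u|i] /=; first exact: lf_idem famE _.
rewrite /block_proj; case: ifP => _; first exact: lvertex_bsum.
by rewrite numulBr (lf_idem famE) lvertex_btot.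
Qed.

Lemma down_lvertex a : down_v a ** lvE (base_v a) = down_v a.
Proof.
case: a => [u|i] /=; first exact: lf_idem famE _.
rewrite /block_proj; case: ifP => _; first exact: bsum_lvertex.
by rewrite numulBl (lf_idem famE) btot_lvertex.
Qed.

Lemma down_orth a b : a <> b -> down_v a ** down_v b = 0.
Proof.
move=> ab; case: (eqVneq (base_v a) (base_v b)) => [|/eqP abN]; last first.
  rewrite -(down_lvertex a) -(lvertex_down b) -mulgA (mulgA (lvE _)).
  by rewrite (lf_orth famE abN) numul0r numulr0.
case: a b ab => [u|i] [u'|i'] //= ab.
- by move=> uu; case: ab; congr inl; apply: val_inj.
- by move=> uw; have := valP u; rewrite /= uw eqxx.
- by move=> uw; have := valP u'; rewrite /= -uw eqxx.
- by rewrite block_projM; case: eqP => // ii; case: ab; rewrite ii.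
Qed.

Lemma down_idem a : down_v a ** down_v a = down_v a.
Proof. by case: a => [u|i] /=; rewrite ?(lf_idem famE) // block_projM eqxx. Qed.

Lemma osrc_inl e u : (osrc e == inl u) = (src e == val u).
Proof.
rewrite /osrc /vertex_copy; case: insubP => [u' _ <-|/negPn/eqP->].
  apply/eqP/eqP => [[->]//|uu]; congr inl; exact: val_inj.
by apply/esym/negbTE; rewrite eq_sym; apply: (valP u).
Qed.

Lemma osrc_inr e i : (osrc e == inr i) = (src e == w) && (c e == i).
Proof.
rewrite /osrc /vertex_copy; case: insubP => [u /negPf-> //|/negPn->].
by apply/eqP/eqP => [[->]|->].
Qed.

Lemma down_edge a e : down_v a ** leE e = if osrc e == a then leE e else 0.
Proof.
case: a => [u|i] /=.
  rewrite osrc_inl -{1}(lf_src famE) mulgA lvertexM (eq_sym (sval u)).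
  by case: ifP => [/eqP<-|_]; rewrite ?(lf_src famE) ?numul0r.
rewrite osrc_inr /block_proj; case: ifPn => fi; first by rewrite bsum_edge mem_blk fi.
rewrite numulBl btot_edge -{1}(lf_src famE) mulgA lvertexM (eq_sym w).
case: eqP => [ew|_] /=; last by rewrite numul0r subrr.
rewrite -ew (lf_src famE); case: eqP => [->|ci]; first by rewrite (negPf fi) subr0.
case: ifPn => [_|fc]; first by rewrite subrr.
by case: ci; apply: fin_unique.
Qed.

Lemma ghost_down a e : lgE e ** down_v a = if osrc e == a then lgE e else 0.
Proof.
case: a => [u|i] /=.
  rewrite osrc_inl -{1}(lf_ghost_src famE) -mulgA lvertexM.
  by case: ifP => _; rewrite ?(lf_ghost_src famE) ?numulr0.
rewrite osrc_inr /block_proj; case: ifPn => fi; first by rewrite ghost_bsum mem_blk fi.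
rewrite numulBr ghost_btot -{1}(lf_ghost_src famE) -mulgA lvertexM.
case: eqP => [ew|_] /=; last by rewrite numulr0 subrr.
rewrite (lf_ghost_src famE); case: eqP => [->|ci]; first by rewrite (negPf fi) subr0.
case: ifPn => [_|fc]; first by rewrite subrr.
by case: ci; apply: fin_unique.
Qed.

(** By construction if there is an infinite block; otherwise [w] is regular and
this is the second Cuntz-Krieger relation at [w]. *)
Lemma sum_block_proj : \sum_i block_proj i = lvE w.
Proof.
have [/existsP[j fj]|/existsPn allfin] := boolP [exists j, ~~ fin j].
  rewrite (bigD1 j) //= {1}/block_proj (negPf fj).
  have -> : \sum_(i | i != j) block_proj i = btot.
    rewrite /btot [RHS](bigD1 j) //= {1}/bsum.
    have -> : blk j = [::] by have [_ _] := blkP j; apply; apply/asboolPn.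
    rewrite big_nil add0r; apply: eq_bigr => i ij; rewrite /block_proj.
    by case: ifPn => // fi; rewrite (fin_unique fi fj) eqxx in ij.
  by rewrite subrK.
have finT i : fin i by have := allfin i; rewrite negbK.
pose s := [seq e | i <- enum 'I_n, e <- blk i].
have sP e : (e \in s) = (src e == w).
  apply/allpairsPdep/eqP => [[i [f [_ fb ->]]]|ew].
    by move: fb; rewrite mem_blk => /and3P[_ /eqP].
  by exists (c e), e; rewrite mem_enum mem_blk finT ew !eqxx.
have sU : uniq s.
  apply: allpairs_uniq_dep => [|i _|]; rewrite ?enum_uniq ?blk_uniq //.
  move=> [i e] [i' e'] /allpairsPdep[x [y [_ yx [-> ->]]]].
  move=> /allpairsPdep[x' [y' [_ yx' [-> ->]]]] /= yy'; subst y'.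
  by move: yx yx'; rewrite !mem_blk => /and3P[_ _ /eqP<-] /and3P[_ _ /eqP<-].
have sE : [set` s] = out_edges w.
  by apply/seteqP; split=> e /=; rewrite sP => /eqP.
have wreg : regular w.
  split; last by rewrite -sE; apply: finite_seq.
  by apply: contra_notP w_nsink => /set0P/negP/negPn/eqP.
rewrite (lf_CK2 famE wreg sU sE) big_allpairs_dep /= big_enum /=.
by apply: eq_bigr => i _; rewrite /block_proj finT.
Qed.

Lemma sum_down v : \sum_(a <- vcopies v) down_v a = lvE v.
Proof.
rewrite /vcopies; case: insubP => [u _ <-|/negPn/eqP->]; first by rewrite big_seq1.
by rewrite big_map big_enum /= sum_block_proj.
Qed.

Lemma down_CK2 a l : regular a -> uniq l ->
  (forall e, (e \in l) = (osrc e == a)) -> down_v a = \sum_(e <- l) leE e ** lgE e.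
Proof.
move=> [[h /[!out_osrc] ha] _] lU; case: a ha => [u|i] /= ha lE'.
  have lu : [set` l] = out_edges (val u).
    by apply/seteqP; split=> e /=; rewrite lE' osrc_inl => /eqP.
  apply: (lf_CK2 famE) => //; split; last by rewrite -lu; apply: finite_seq.
  exists (base_e h); rewrite /out_edges /=.
  by apply/eqP; rewrite -osrc_inl ha.
have fi : fin i.
  apply/asboolP/finite_seqP; exists l; apply/seteqP; split=> e /=.
    by move=> [ew ei]; rewrite lE' osrc_inr; apply/andP; split; apply/eqP.
  by rewrite lE' osrc_inr => /andP[/eqP ew /eqP ei].
rewrite /block_proj fi /bsum; apply: perm_big.
apply: uniq_perm => //; first exact: blk_uniq.
by move=> e; rewrite lE' osrc_inr mem_blk fi.
Qed.

Lemma down_family : leavitt_family down_v down_e down_g.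
Proof.
split.
- exact: down_idem.
- exact: down_orth.
- by move=> h; rewrite /down_e mulgA down_edge -src_base eqxx.
- by move=> h; rewrite /down_e -mulgA down_idem.
- by move=> h; rewrite /down_g mulgA down_idem.
- by move=> h; rewrite /down_g -mulgA ghost_down -src_base eqxx.
- move=> h; rewrite /down_g /down_e mulgA -(mulgA _ (lgE _)) (lf_CK1 famE).
  by rewrite -base_rng down_lvertex down_idem.
- move=> h h' hh'; rewrite /down_g /down_e mulgA -(mulgA _ (lgE _)).
  case: (eqVneq (base_e h) (base_e h')) => [bb|/eqP bb]; last first.
    by rewrite (lf_CK1_orth famE bb) numulr0 numul0r.
  rewrite bb (lf_CK1 famE) -bb -base_rng down_lvertex down_orth // => rr.
  by apply: hh'; apply: rng_ecopies_inj.
- move=> a l areg lU la; have [l' l'U l'E] := regular_copy_list areg.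
  have [U UE] := out_copies l'U l'E.
  rewrite (down_CK2 areg l'U l'E).
  have ll : perm_eq l (flatten [seq ecopies e | e <- l']).
    apply: uniq_perm => // h; apply/idP/idP => hl.
      by have : [set` l] h by []; rewrite la -UE.
    by have : [set` flatten [seq ecopies e | e <- l']] h by []; rewrite UE -la.
  rewrite (perm_big _ ll) /= sum_flatten_copies; apply: eq_bigr => e _.
  rewrite -{1}(lf_rng famE) -sum_down -sum_vcopies_rng numul_sumr numul_suml.
  rewrite big_seq [RHS]big_seq; apply: eq_bigr => h; rewrite mem_ecopies => /eqP he.
  by rewrite /down_e /down_g he -{1}(down_idem (rng h)) !mulgA.
Qed.

(** The two maps are inverse to each other on generators: the copies of [w] and
the pieces of [w] correspond, and [e] times the piece at its range is one copy. *)
Lemma moveO_iso :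
  subalg_iso (corner K [set: vertex E]) (corner K [set: vertex F]).
Proof.
have [up [upH upv upe upg]] := leavitt_lift up_family.
have [down [downH downv downe downg]] := leavitt_lift down_family.
have up_bsum i : up (bsum i) = if fin i then lvF (inr i) else 0.
  rewrite (hom_sum upH) -/(blk i).
  case: ifPn => fi; last first.
    have -> : blk i = [::] by have [_ _] := blkP i; apply; apply/asboolPn.
    by rewrite big_nil.
  under eq_bigr do rewrite (homM upH) upe upg.
  have bi e : (e \in blk i) = (osrc e == inr i :> vertex F).
    by rewrite mem_blk fi osrc_inr.
  apply/esym/(up_CK2_copy _ (blk_uniq i) bi).
  have [e0 [e0w e0i]] := c_blocks i; apply: (regular_copy (blk_uniq i) bi (e0 := e0)).
  by rewrite mem_blk fi [src e0]e0w [c e0]e0i !eqxx.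
have up_down_v a : up (down_v a) = lvF a.
  case: a => [u|i] /=.
    by rewrite upv /up_v /vcopies valK /usum big_seq1.
  rewrite /block_proj; case: ifPn => fi; first by rewrite up_bsum fi.
  rewrite (homD upH) (homN upH) upv /btot (hom_sum upH).
  under eq_bigr do rewrite up_bsum.
  rewrite /up_v /vcopies insubF ?eqxx // /usum big_map big_enum /=.
  rewrite (bigD1 i) //= [X in _ - X](bigD1 i) //= (negPf fi) add0r.
  rewrite [X in _ - X](_ : _ = \sum_(k | k != i) lvF (inr k)) ?addrK //.
  apply: eq_bigr => k ki; case: ifPn => // fk.
  by rewrite (fin_unique fk fi) eqxx in ki.
have upK : cancel down up.
  apply: (leavitt_hom_ext (hom_comp upH downH) (hom_id _)) => [a|h|h] /=.
  - by rewrite downv.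
  - rewrite downe (homM upH) upe up_down_v /up_e numul_suml.
    rewrite (bigD1_seq h) ?ecopies_uniq ?mem_ecopies //= (lf_rng famF).
    rewrite big_seq_cond big1 ?addr0 // => h'.
    rewrite mem_ecopies => /andP[/eqP bb /eqP hh'].
    rewrite -(lf_rng famF) -mulgA (lf_orth famF) ?numulr0 // => rr.
    by apply: hh'; apply: rng_ecopies_inj.
  - rewrite downg (homM upH) upg up_down_v /up_g numul_sumr.
    rewrite (bigD1_seq h) ?ecopies_uniq ?mem_ecopies //= (lf_ghost_rng famF).
    rewrite big_seq_cond big1 ?addr0 // => h'.
    rewrite mem_ecopies => /andP[/eqP bb /eqP hh'].
    rewrite -(lf_ghost_rng famF) mulgA (lf_orth famF) ?numul0r // => rr.
    by apply: hh'; apply: rng_ecopies_inj.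
have downK : cancel up down.
  apply: (leavitt_hom_ext (hom_comp downH upH) (hom_id _)) => [v|e|e] /=.
  - rewrite upv /up_v /usum (hom_sum downH).
    by under eq_bigr do rewrite downv; rewrite sum_down.
  - rewrite upe (hom_sum downH) -[RHS](lf_rng famE) -sum_down -sum_vcopies_rng.
    rewrite numul_sumr big_seq [RHS]big_seq; apply: eq_bigr => h.
    by rewrite mem_ecopies downe /down_e => /eqP->.
  - rewrite upg (hom_sum downH) -[RHS](lf_ghost_rng famE) -sum_down -sum_vcopies_rng.
    rewrite numul_suml big_seq [RHS]big_seq; apply: eq_bigr => h.
    by rewrite mem_ecopies downg /down_g => /eqP->.
exists up; split; [split | | |].
- by move=> x _; apply: corner_setT.
- by move=> x y _ _; apply: (can_inj downK).
- by move=> y _; exists (down y); [apply: corner_setT | rewrite upK].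
- by move=> x y _ _; apply: homD.
- by move=> x y _ _; apply: homM.
- by move=> k x _; apply: homZ.
Qed.

End OutSplit.

(** * Equivalences of categories *)

Lemma equivalence_criterion (C D : category) (F : functor C D) :
    (forall a b (f g : Defs.hom a b), fmap F f = fmap F g -> f = g) ->
    (forall a b (g : Defs.hom (F a) (F b)), exists f, fmap F f = g) ->
    (forall d, exists (c : obj C) (p : Defs.hom (F c) d) (q : Defs.hom d (F c)),
       ccomp p q = idm d /\ ccomp q p = idm (F c)) ->
  equivalent_categories C D.
Proof.
move=> faith full ess.
pose G0 d := projT1 (cid (ess d)).
pose H1 d := projT2 (cid (ess d)).
pose p d : Defs.hom (F (G0 d)) d := projT1 (cid (H1 d)).
pose H2 d := projT2 (cid (H1 d)).
pose q d : Defs.hom d (F (G0 d)) := projT1 (cid (H2 d)).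
have pq d : ccomp (p d) (q d) = idm d by case: (projT2 (cid (H2 d))).
have qp d : ccomp (q d) (p d) = idm (F (G0 d)) by case: (projT2 (cid (H2 d))).
pose L a b (g : Defs.hom (F a) (F b)) : Defs.hom a b := projT1 (cid (full a b g)).
have LK a b (g : Defs.hom (F a) (F b)) : fmap F (L a b g) = g.
  exact: projT2 (cid (full a b g)).
pose G1 a b (f : Defs.hom a b) : Defs.hom (G0 a) (G0 b) :=
  L _ _ (ccomp (q b) (ccomp f (p a))).
have G11 a : G1 a a (idm a) = idm (G0 a).
  by apply: faith; rewrite LK fmap1 ccomp1m qp.
have G1M a b c (f : Defs.hom b c) (g : Defs.hom a b) :
    G1 a c (ccomp f g) = ccomp (G1 b c f) (G1 a b g).
  apply: faith; rewrite fmapM !LK -!ccompA; congr ccomp.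
  by rewrite (ccompA (p b)) pq ccomp1m.
pose G := @Functor D C G0 G1 G11 G1M.
exists F, G; split.
- exists (fun a => L _ _ (p (F a))), (fun a => L _ _ (q (F a))); split.
  + move=> a b f; apply: faith; rewrite !fmapM !LK /=.
    by rewrite ccompA pq ccomp1m.
  + by move=> a; apply: faith; rewrite fmapM !LK fmap1 /= qp.
  + by move=> a; apply: faith; rewrite fmapM !LK fmap1 /= pq.
- exists p, q; split.
  + by move=> a b f /=; rewrite /G1 LK ccompA pq ccomp1m.
  + by move=> a; apply: qp.
  + by move=> a; apply: pq.
Qed.

Lemma equivalent_categories_refl C : equivalent_categories C C.
Proof.
by exists (idf C), (idf C); split; exists (@idm C), (@idm C); split=> [a b f|a|a] /=;
  rewrite ?ccomp1m ?ccompm1.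
Qed.

Lemma equivalent_categories_sym C D :
  equivalent_categories C D -> equivalent_categories D C.
Proof. by move=> [F [G [FG GF]]]; exists G, F. Qed.

(** Both natural isomorphisms of a composite of two equivalences have this
form. *)
Lemma natural_iso_sandwich C D (F : functor C D) (G : functor D C)
    (H : functor D D) :
    natural_iso (compf G F) (idf C) -> natural_iso H (idf D) ->
  natural_iso (compf G (compf H F)) (idf C).
Proof.
move=> [t [u [tN ut tu]]] [t' [u' [t'N ut' tu']]].
exists (fun a => ccomp (t a) (fmap G (t' (F a)))).
exists (fun a => ccomp (fmap G (u' (F a))) (u a)); split.
- move=> a b f /=; have /= N := tN a b f; have /= N' := t'N _ _ (fmap F f).
  transitivity (ccomp (ccomp (t b) (fmap G (fmap F f))) (fmap G (t' (F a)))).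
    by rewrite -!ccompA -!fmapM N'.
  by rewrite ccompA; congr (ccomp _ _); exact: N.
- move=> a /=; rewrite ccompA -(ccompA _ (u a)) ut /= ccompm1 -fmapM ut'.
  by rewrite fmap1.
- move=> a /=; rewrite ccompA -(ccompA (t a)) -fmapM tu' /= fmap1 ccompm1.
  exact: tu.
Qed.

Lemma equivalent_categories_trans C D B : equivalent_categories C D ->
  equivalent_categories D B -> equivalent_categories C B.
Proof.
move=> [F [G [GF FG]]] [F' [G' [GF' FG']]].
exists (compf F' F), (compf G G'); split.
  exact: (natural_iso_sandwich GF GF').
exact: (natural_iso_sandwich FG' FG).
Qed.

(** * Corners and Morita equivalence *)

Definition local_units (R : nuRingType) : Prop :=
  forall a b : R, exists u : R,
    [/\ u ** a = a, a ** u = a, u ** b = b & b ** u = b].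

Section UnitalModule.
Variables (R : nuRingType) (M : umod R).
Local Notation act := (@umod_act R M).

Lemma act0m m : act 0 m = 0.
Proof. by apply: (addrI (act 0 m)); rewrite -umod_actDl !addr0. Qed.

Lemma actm0 a : act a 0 = 0.
Proof. by apply: (addrI (act a 0)); rewrite -umod_actDr !addr0. Qed.

Lemma actNm a m : act (- a) m = - act a m.
Proof. by apply: (addrI (act a m)); rewrite -umod_actDl !subrr act0m. Qed.

Lemma actmN a m : act a (- m) = - act a m.
Proof. by apply: (addrI (act a m)); rewrite -umod_actDr !subrr actm0. Qed.

Lemma act_suml (I : Type) (s : seq I) (P : pred I) (F : I -> R) m :
  act (\sum_(i <- s | P i) F i) m = \sum_(i <- s | P i) act (F i) m.
Proof.
exact: (big_morph (fun a => act a m) (fun a b => umod_actDl a b m) (act0m m)).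
Qed.

Lemma act_sumr (I : Type) (s : seq I) (P : pred I) a (F : I -> M) :
  act a (\sum_(i <- s | P i) F i) = \sum_(i <- s | P i) act a (F i).
Proof. exact: (big_morph (act a) (umod_actDr a) (actm0 a)). Qed.

Hypothesis R_units : local_units R.

Lemma local_units_seq (s : seq R) : exists u : R,
  forall a, a \in s -> u ** a = a /\ a ** u = a.
Proof.
elim: s => [|a s [u uP]]; first by exists 0.
have [v [va av vu uv]] := R_units a u.
exists v => b; rewrite inE => /predU1P[->|/uP[ub bu]]; first by split.
by split; [rewrite -ub mulgA vu | rewrite -bu -mulgA uv].
Qed.

Lemma umod_fix m : exists u, act u m = m.
Proof.
have [s ms] := umod_unital m; have [u uP] := local_units_seq (map fst s).
exists u; rewrite ms act_sumr big_seq [RHS]big_seq; apply: eq_bigr => t ts.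
rewrite -umod_actM; have [->] := uP t.1 (map_f fst ts).
by [].
Qed.

End UnitalModule.

Section UmodHom.
Variables (R : nuRingType) (M N : umod R) (f : M -> N).
Hypothesis fH : is_umod_hom f.

Lemma umod_homD x y : f (x + y) = f x + f y. Proof. by case: fH. Qed.
Lemma umod_homA a x : f (umod_act a x) = umod_act a (f x).
Proof. by case: fH => _ ->. Qed.
Lemma umod_hom0 : f 0 = 0.
Proof. by apply: (addrI (f 0)); rewrite -umod_homD !addr0. Qed.
Lemma umod_homN x : f (- x) = - f x.
Proof. by apply: (addrI (f x)); rewrite -umod_homD !subrr umod_hom0. Qed.
Lemma umod_hom_sum (I : Type) (s : seq I) (P : pred I) (F : I -> M) :
  f (\sum_(i <- s | P i) F i) = \sum_(i <- s | P i) f (F i).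
Proof. exact: (big_morph f umod_homD umod_hom0). Qed.

End UmodHom.

(** The corner is given as a ring [A] embedded in [R], so that one ring can be
seen as a corner of two different algebras. *)
Section CornerMorita.
Variables (A R : nuRingType) (i : A -> R).
Hypotheses (iD : {morph i : x y / x + y}) (iM : {morph i : x y / x ** y}).
Hypothesis i_inj : injective i.
Hypothesis i_corner : forall a r b, exists c, i a ** r ** i b = i c.
Hypotheses (A_units : local_units A) (R_units : local_units R).
Hypothesis R_full : forall x, exists s : seq (R * R * R),
  (forall t, t \in s -> exists a, i a = t.1.2) /\
  x = \sum_(t <- s) t.1.1 ** t.1.2 ** t.2.

Section Cut.
Variable M : umod R.

(** The elements of [A M]: thanks to local units, those fixed by some element of
[A]. *)
Definition cut_pred : {pred M} := fun m => `[< exists a, umod_act (i a) m = m >].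

Lemma cutP m : reflect (exists a, umod_act (i a) m = m) (m \in cut_pred).
Proof. exact: asboolP. Qed.

Fact cut_closed : zmod_closed cut_pred.
Proof.
split; first by apply/cutP; exists 0; rewrite actm0.
move=> x y /cutP[a ax] /cutP[b yb]; have [u [ua _ ub _]] := A_units a b.
apply/cutP; exists u; rewrite umod_actDr actmN -{1}ax -{1}yb -!umod_actM -!iM.
by rewrite ua ub ax yb.
Qed.

HB.instance Definition _ := GRing.isZmodClosed.Build M cut_pred cut_closed.

Definition cut : Type := {m : M | m \in cut_pred}.
HB.instance Definition _ := SubType.on cut.
HB.instance Definition _ := Choice.on cut.
HB.instance Definition _ := [SubChoice_isSubZmodule of cut by <:].

Fact cut_act_subproof a (m : M) : umod_act (i a) m \in cut_pred.
Proof.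
have [u [ua _ _ _]] := A_units a a; apply/cutP; exists u.
by rewrite -umod_actM -iM ua.
Qed.

Definition cut_mk a (m : M) : cut :=
  exist (fun x : M => x \in cut_pred) _ (cut_act_subproof a m).
Definition cut_act a (m : cut) : cut := cut_mk a (val m).

Lemma cut_fix (m : cut) : exists a, umod_act (i a) (val m) = val m.
Proof. by apply/cutP; apply: valP m. Qed.

Fact cut_actM a b m : cut_act (a ** b) m = cut_act a (cut_act b m).
Proof. by apply: val_inj; rewrite /= iM umod_actM. Qed.
Fact cut_actDl a b m : cut_act (a + b) m = cut_act a m + cut_act b m.
Proof. by apply: val_inj; rewrite /= iD umod_actDl. Qed.
Fact cut_actDr a m n : cut_act a (m + n) = cut_act a m + cut_act a n.
Proof. by apply: val_inj; rewrite /= umod_actDr. Qed.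
Fact cut_unital m : exists s : seq (A * cut),
  m = \sum_(t <- s) cut_act t.1 t.2.
Proof.
have [a am] := cut_fix m; exists [:: (a, m)]; rewrite big_seq1.
exact/esym/val_inj.
Qed.

Definition cut_umod : umod A := UMod cut_actM cut_actDl cut_actDr cut_unital.

Lemma cut_gen (m : M) : exists s : seq (R * cut),
  m = \sum_(t <- s) umod_act t.1 (val t.2).
Proof.
have [u um] := umod_fix R_units m; have [s [sP us]] := R_full u.
have [s' s'E] : exists s' : seq (R * cut), umod_act u m =
    \sum_(t <- s') umod_act t.1 (val t.2).
  rewrite us act_suml; elim: s sP {us} => [|[[x b] y] s IHs] sP.
    by exists [::]; rewrite !big_nil.
  have [|s' s'E] := IHs; first by move=> t ts; apply: sP; rewrite inE ts orbT.
  have [/= a ab] := sP _ (mem_head _ _).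
  exists ((x, cut_mk a (umod_act y m)) :: s').
  by rewrite !big_cons s'E /= ab !umod_actM.
by exists s'; rewrite -um s'E.
Qed.

(** Fullness gives [m = u m] with [u] in [R A R]. *)
Lemma corner_faithful (m : M) :
  (forall a x, umod_act (i a) (umod_act x m) = 0) -> m = 0.
Proof.
move=> m0; have [u um] := umod_fix R_units m; have [s [sP us]] := R_full u.
rewrite -um us act_suml big1_seq // => t /= /sP[a at2].
by rewrite -at2 !umod_actM m0 actm0.
Qed.

End Cut.

Fact cut_hom_subproof (M N : umod R) (f : umod_hom M N) (m : cut_umod M) :
  sval f (val m) \in @cut_pred N.
Proof.
have [a am] := cut_fix m; apply/cutP; exists a.
by rewrite -(umod_homA (svalP f)) am.
Qed.

Definition cut_fun (M N : umod R) (f : umod_hom M N) (m : cut_umod M) :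
  cut_umod N :=
  exist (fun x : N => x \in @cut_pred N) _ (cut_hom_subproof f m).

Fact cut_fun_hom (M N : umod R) (f : umod_hom M N) : is_umod_hom (cut_fun f).
Proof.
split=> [x y|a x]; apply: val_inj => /=.
  exact: umod_homD (svalP f) _ _.
exact: umod_homA (svalP f) _ _.
Qed.

Definition cut_hom (M N : umod R) (f : umod_hom M N) :
  umod_hom (cut_umod M) (cut_umod N) := exist _ _ (cut_fun_hom f).

Fact cut_hom1 M : cut_hom (umod_id M) = umod_id (cut_umod M).
Proof. by apply/umod_hom_eq/funext => m; apply: val_inj. Qed.

Fact cut_homM M N P (f : umod_hom N P) (g : umod_hom M N) :
  cut_hom (umod_comp f g) = umod_comp (cut_hom f) (cut_hom g).
Proof. by apply/umod_hom_eq/funext => m; apply: val_inj. Qed.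

Definition cut_functor : functor (umod_category R) (umod_category A) :=
  @Functor (umod_category R) (umod_category A) cut_umod cut_hom cut_hom1 cut_homM.

Lemma cut_functor_faithful (M N : umod R) (f g : umod_hom M N) :
  cut_hom f = cut_hom g -> f = g.
Proof.
move=> fg; apply/umod_hom_eq/funext => m; have [s ->] := cut_gen m.
rewrite (umod_hom_sum (svalP f)) (umod_hom_sum (svalP g)); apply: eq_bigr => t _.
rewrite (umod_homA (svalP f)) (umod_homA (svalP g)); congr umod_act.
by have /(congr1 val) := congr1 (fun h => sval h t.2) fg.
Qed.

(** A morphism [g] between the cuts of [M] and [N] extends to [M] by sending
[sum r m] to [sum r g(m)], for [m] in the cut. *)
Section Extension.
Variables (M N : umod R) (g : umod_hom (cut_umod M) (cut_umod N)).

Lemma hom_cut_act d (m : cut M) :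
  cut_act d (sval g m : cut N) = sval g (cut_act d m) :> cut N.
Proof. exact: esym (umod_homA (svalP g) d m). Qed.

Lemma hom_cut_fix d (m : cut M) : umod_act (i d) (val m) = val m ->
  umod_act (i d) (val (sval g m : cut N)) = val (sval g m : cut N).
Proof.
move=> dm; rewrite -[LHS]/(val (cut_act d (sval g m : cut N))) hom_cut_act.
by congr (val (sval g _ : cut N)); apply: val_inj.
Qed.

Definition ext_sum (s : seq (R * cut M)) : N :=
  \sum_(t <- s) umod_act t.1 (val (sval g t.2)).

(** By faithfulness it suffices to multiply by [a x] with [a] in [A]. The
product [a x r d] belongs to [A] when [d] in [A] fixes [m], so that it can be moved
into the argument of [g]. *)
Lemma ext_sum0 (s : seq (R * cut M)) :
  \sum_(t <- s) umod_act t.1 (val t.2) = 0 -> ext_sum s = 0.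
Proof.
move=> s0; apply: corner_faithful => a x; rewrite -!umod_actM.
have [b bP] : exists b : R * cut M -> A, forall t, t \in s ->
    umod_act (i a ** x ** t.1) (val t.2) = val (cut_act (b t) t.2) /\
    umod_act (i a ** x ** t.1) (val (sval g t.2)) =
      val (cut_act (b t) (sval g t.2)).
  suff /choice[b bP] : forall t : R * cut M, exists c : A,
      umod_act (i a ** x ** t.1) (val t.2) = val (cut_act c t.2) /\
      umod_act (i a ** x ** t.1) (val (sval g t.2)) =
        val (cut_act c (sval g t.2)) by exists b => t _; apply: bP.
  move=> t; have [d dt] := cut_fix t.2.
  have [c cE] := i_corner a (x ** t.1) d; exists c.
  have gt := hom_cut_fix dt.
  by rewrite -{1}dt -{1}gt -!umod_actM -!(mulgA (i a)) /= -cE !mulgA.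
rewrite act_sumr (eq_big_seq (fun t => val (sval g (cut_act (b t) t.2)))).
  rewrite -[LHS](raddf_sum val) -(umod_hom_sum (svalP g)).
  rewrite (_ : \sum_(t <- s) _ = 0) ?(umod_hom0 (svalP g)) //.
  apply: val_inj; rewrite raddf_sum /=.
  transitivity (umod_act (i a ** x) (\sum_(t <- s) umod_act t.1 (val t.2))).
    rewrite act_sumr; apply: eq_big_seq => t ts.
    by rewrite -umod_actM; have [-> _] := bP t ts.
  by rewrite s0 actm0.
move=> t ts; rewrite -hom_cut_act.
by rewrite -umod_actM; have [_ ->] := bP t ts.
Qed.

Lemma ext_sum_wd (s t : seq (R * cut M)) :
    \sum_(u <- s) umod_act u.1 (val u.2) = \sum_(u <- t) umod_act u.1 (val u.2) ->
  ext_sum s = ext_sum t.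
Proof.
move=> st; pose t' := [seq (- u.1, u.2) | u <- t].
have : ext_sum (s ++ t') = 0.
  apply: ext_sum0; rewrite big_cat big_map /= st -big_split big1 //= => u _.
  by rewrite actNm subrr.
rewrite /ext_sum big_cat big_map /= => /eqP; rewrite addr_eq0 => /eqP->.
by rewrite -sumrN; apply: eq_bigr => u _; rewrite actNm opprK.
Qed.

Definition ext_fun (m : M) : N := ext_sum (projT1 (cid (cut_gen m))).

Lemma ext_funE (s : seq (R * cut M)) :
  ext_fun (\sum_(t <- s) umod_act t.1 (val t.2)) = ext_sum s.
Proof. by apply: ext_sum_wd; rewrite -(projT2 (cid (cut_gen _))). Qed.

Lemma ext_fun_hom : is_umod_hom ext_fun.
Proof.
split=> [x y|a x].
  have [s ->] := cut_gen x; have [t ->] := cut_gen y.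
  by rewrite -big_cat !ext_funE /ext_sum big_cat.
have [s ->] := cut_gen x; rewrite ext_funE.
pose s' := [seq (a ** t.1, t.2) | t <- s].
have -> : umod_act a (\sum_(t <- s) umod_act t.1 (val t.2)) =
          \sum_(t <- s') umod_act t.1 (val t.2).
  by rewrite act_sumr big_map; apply: eq_bigr => t _; rewrite umod_actM.
rewrite ext_funE /ext_sum act_sumr big_map; apply: eq_bigr => t _.
by rewrite umod_actM.
Qed.

Lemma cut_functor_full : exists f : umod_hom M N, cut_hom f = g.
Proof.
exists (exist _ _ ext_fun_hom); apply/umod_hom_eq/funext => m; apply: val_inj => /=.
have [a am] := cut_fix m.
have {1}-> : val m = \sum_(t <- [:: (i a, m)]) umod_act t.1 (val t.2).
  by rewrite big_seq1.
rewrite ext_funE /ext_sum big_seq1; exact: hom_cut_fix.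
Qed.

End Extension.

(** The module [R A (x) N] over [R], and the isomorphism of its cut with [N]. A
sum of tensors vanishes if and only if it is killed by all the maps
[r b (x) n |-> (a x r b) n] into [N], with [a] in [A] and [x] in [R]. So a sum of
tensors is represented by the function of the pair [(a, x)] that it defines, and
[R] acts by translation of [x]. *)
Section Induction.
Variable N : umod A.
Local Notation act := (@umod_act A N).

Lemma corner_inv_exists : exists k : R -> A, forall a, k (i a) = a.
Proof. exact: inj_factor id 0 i_inj. Qed.

Let k := projT1 (cid corner_inv_exists).
Let kK a : k (i a) = a.
Proof. exact: projT2 (cid corner_inv_exists) a. Qed.

(** The function of the tensor [r b (x) n]; [k] is the inverse of [i] on the
corner, where [a x r b] lies. *)
Definition tens (t : R * A * N) : A * R -> N :=
  fun p => act (k (i p.1 ** p.2 ** t.1.1 ** i t.1.2)) t.2.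

Definition tens_sum (s : seq (R * A * N)) : A * R -> N := \sum_(t <- s) tens t.

Lemma tens_sumE s p : tens_sum s p = \sum_(t <- s) tens t p.
Proof. by rewrite /tens_sum fct_sumE. Qed.

Definition ind_pred : {pred A * R -> N} := fun phi => `[< exists s, phi = tens_sum s >].

Lemma indP phi : reflect (exists s, phi = tens_sum s) (phi \in ind_pred).
Proof. exact: asboolP. Qed.

Lemma tensN r b n p : tens (r, b, - n) p = - tens (r, b, n) p.
Proof. by rewrite /tens actmN. Qed.

Fact ind_closed : zmod_closed ind_pred.
Proof.
split; first by apply/indP; exists [::]; rewrite /tens_sum big_nil.
move=> _ _ /indP[s ->] /indP[t ->]; apply/indP.
exists (s ++ [seq (u.1, - u.2) | u <- t]); apply/funext => p.
rewrite tens_sumE big_cat big_map /=.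
rewrite -[LHS]/(tens_sum s p - tens_sum t p) !tens_sumE -sumrN.
by congr (_ + _); apply: eq_bigr => -[[r b] n] _; rewrite tensN.
Qed.

HB.instance Definition _ :=
  GRing.isZmodClosed.Build (A * R -> N) ind_pred ind_closed.

Definition ind : Type := {phi : A * R -> N | phi \in ind_pred}.
HB.instance Definition _ := SubType.on ind.
HB.instance Definition _ := Choice.on ind.
HB.instance Definition _ := [SubChoice_isSubZmodule of ind by <:].

Lemma ind_ext (f g : ind) : (forall a x, val f (a, x) = val g (a, x)) -> f = g.
Proof. by move=> fg; apply/val_inj/funext => -[a x]. Qed.

Lemma tens_shift y r b n a x :
  tens (y ** r, b, n) (a, x) = tens (r, b, n) (a, x ** y).
Proof. by rewrite /tens /= !mulgA. Qed.

Lemma tens_sum_shift y s a x :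
  tens_sum [seq (y ** t.1.1, t.1.2, t.2) | t <- s] (a, x) =
  tens_sum s (a, x ** y).
Proof.
rewrite !tens_sumE big_map; apply: eq_bigr => -[[r b] n] _.
exact: tens_shift.
Qed.

Fact ind_act_subproof y (f : ind) :
  (fun p => val f (p.1, p.2 ** y)) \in ind_pred.
Proof.
case: f => f /= /indP[s ->]; apply/indP.
exists [seq (y ** t.1.1, t.1.2, t.2) | t <- s].
by apply/funext => -[a x]; rewrite tens_sum_shift.
Qed.

Definition ind_act y (f : ind) : ind :=
  exist (fun phi => phi \in ind_pred) _ (ind_act_subproof y f).

Lemma ind_actE y f a x : val (ind_act y f) (a, x) = val f (a, x ** y).
Proof. by []. Qed.

Lemma ind_addE (f g : ind) p : val (f + g) p = val f p + val g p.
Proof. by []. Qed.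

Definition ind_of (s : seq (R * A * N)) : ind :=
  exist (fun phi => phi \in ind_pred) (tens_sum s)
    (introT (indP _) (ex_intro _ s erefl)).

Lemma ind_ofP (f : ind) : exists s, f = ind_of s.
Proof.
case: f => f fP; have /indP[s fs] := fP; exists s.
by apply: val_inj => /=.
Qed.

Lemma kD a x y b c :
  act (k (i a ** (x + y) ** c ** i b)) =1
  fun n => act (k (i a ** x ** c ** i b)) n + act (k (i a ** y ** c ** i b)) n.
Proof.
move=> n; rewrite numulDr !numulDl.
have [d dE] := i_corner a (x ** c) b; have [e eE] := i_corner a (y ** c) b.
by rewrite !mulgA in dE eE; rewrite dE eE -iD !kK umod_actDl.
Qed.

Fact ind_actM y z f : ind_act (y ** z) f = ind_act y (ind_act z f).
Proof. by apply: ind_ext => a x; rewrite !ind_actE mulgA. Qed.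
Fact ind_actDl y z f : ind_act (y + z) f = ind_act y f + ind_act z f.
Proof.
apply: ind_ext => a x; rewrite ind_addE !ind_actE numulDr.
have [s ->] := ind_ofP f; rewrite /= !tens_sumE -big_split; apply: eq_bigr => t _.
by rewrite /tens /= kD.
Qed.
Fact ind_actDr y f g : ind_act y (f + g) = ind_act y f + ind_act y g.
Proof. by apply: ind_ext. Qed.
Fact ind_unital f : exists s : seq (R * ind), f = \sum_(t <- s) ind_act t.1 t.2.
Proof.
have [s ->] := ind_ofP f.
have [u uP] := local_units_seq R_units (map (fun t => t.1.1) s).
exists [:: (u, ind_of s)]; rewrite big_seq1; apply: ind_ext => a x.
rewrite ind_actE /= -tens_sum_shift !tens_sumE big_map; apply: eq_big_seq.
move=> -[[r b] n] ts /=; have [|-> _//] := uP r.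
by apply/mapP; exists (r, b, n).
Qed.

Definition ind_umod : umod R := UMod ind_actM ind_actDl ind_actDr ind_unital.

Lemma A_fix (n : N) : exists u, act u n = n.
Proof. exact: umod_fix. Qed.

Let unit_of n := projT1 (cid (A_fix n)).
Let unit_ofP n : act (unit_of n) n = n.
Proof. exact: projT2 (cid (A_fix n)). Qed.

(** The element [u (x) n], where [u] fixes [n]; it does not depend on [u]
([theta_any]). *)
Definition theta (n : N) : A * R -> N :=
  fun p => act (k (i p.1 ** p.2 ** i (unit_of n))) n.

Lemma theta_any n u a x : act u n = n ->
  theta n (a, x) = act (k (i a ** x ** i u)) n.
Proof.
move=> un; rewrite /theta /=; set v := unit_of n.
have [w [wu _ wv _]] := A_units u v.
have [c cE] := i_corner a x w.
rewrite -{1}wv -{1}wu !iM !mulgA cE -!iM !kK !umod_actM un.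
by rewrite unit_ofP.
Qed.

Fact theta_subproof n : theta n \in ind_pred.
Proof.
have [w [wu _ _ _]] := A_units (unit_of n) (unit_of n).
apply/indP; exists [:: (i w, unit_of n, n)]; apply/funext => p.
by rewrite tens_sumE big_seq1 /theta /tens /= -(mulgA _ (i w)) -iM wu.
Qed.

Definition theta_ind n : ind :=
  exist (fun phi => phi \in ind_pred) _ (theta_subproof n).

Lemma theta_indD n m : theta_ind (n + m) = theta_ind n + theta_ind m.
Proof.
apply: ind_ext => a x; rewrite ind_addE /=.
have [w [wn _ wm _]] := A_units (unit_of n) (unit_of m).
have wn' : act w n = n by rewrite -[in LHS](unit_ofP n) -umod_actM wn unit_ofP.
have wm' : act w m = m by rewrite -[in LHS](unit_ofP m) -umod_actM wm unit_ofP.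
rewrite (theta_any _ _ wn') (theta_any _ _ wm') -umod_actDr; apply: theta_any.
by rewrite umod_actDr wn' wm'.
Qed.

Lemma theta_act b n a x : theta (act b n) (a, x) = act (k (i a ** x ** i b)) n.
Proof.
have [w [wb _ _ _]] := A_units b b.
rewrite (@theta_any _ w); last by rewrite -umod_actM wb.
have [c cE] := i_corner a x w.
by rewrite -[in RHS]wb iM mulgA cE -iM !kK umod_actM.
Qed.

Lemma theta_indA b n : theta_ind (act b n) = ind_act (i b) (theta_ind n).
Proof.
apply: ind_ext => a x; rewrite ind_actE /= theta_act /theta /=.
have [c cE] := i_corner a x b.
by rewrite mulgA cE -iM !kK umod_actM unit_ofP.
Qed.

Fact theta_cut n : theta_ind n \in @cut_pred ind_umod.
Proof.
by apply/cutP; exists (unit_of n); rewrite /= -theta_indA unit_ofP.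
Qed.

Definition theta_fun (n : N) : cut_umod ind_umod :=
  exist (fun x : ind_umod => x \in @cut_pred ind_umod) _ (theta_cut n).

Fact theta_hom : is_umod_hom theta_fun.
Proof.
split=> [n m|b n]; apply: val_inj => /=; first exact: theta_indD.
exact: theta_indA.
Qed.

Lemma theta_inj : injective theta_fun.
Proof.
move=> n m nm; apply/eqP; rewrite -subr_eq0; apply/eqP.
have th0 : theta_fun (n - m) = 0.
  by rewrite (umod_homD theta_hom) (umod_homN theta_hom) nm subrr.
have := congr1 (fun f : cut_umod ind_umod =>
  val (val f : ind) (unit_of (n - m), i (unit_of (n - m)))) th0.
rewrite /= /theta /= -!iM kK !umod_actM !unit_ofP => ->.
by [].
Qed.

(** An element of the cut is [a f] for some [a] in [A], and
[a (r b (x) m)] is the image of [(a r b) m]. *)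
Lemma theta_surj f : exists n, theta_fun n = f.
Proof.
have [a0 fa0] := cut_fix f; have [s fs] := ind_ofP (val f).
suff [n nE] : exists n, theta_ind n = ind_act (i a0) (ind_of s).
  by exists n; apply: val_inj; rewrite /= nE -fs.
elim: s {fs} => [|[[r b] m] s [n nE]].
  exists 0; apply: ind_ext => a x; rewrite ind_actE /= tens_sumE big_nil.
  by rewrite /theta actm0.
have [c cE] := i_corner a0 r b; exists (act c m + n).
rewrite theta_indD nE; apply: ind_ext => a x; rewrite ind_addE !ind_actE /=.
rewrite !tens_sumE big_cons; congr (_ + _).
by rewrite theta_act -cE /tens /= !mulgA.
Qed.

Lemma cut_functor_ess : exists (M : umod R) (p : umod_hom (cut_umod M) N)
    (q : umod_hom N (cut_umod M)),
  umod_comp p q = umod_id N /\ umod_comp q p = umod_id (cut_umod M).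
Proof.
pose inv f := projT1 (cid (theta_surj f)).
have thetaK f : theta_fun (inv f) = f by exact: projT2 (cid (theta_surj f)).
have inv_hom : is_umod_hom inv.
  split=> [f g|a f]; apply: theta_inj.
    by rewrite (umod_homD theta_hom) !thetaK.
  by rewrite (umod_homA theta_hom) !thetaK.
exists ind_umod, (exist _ _ inv_hom), (exist _ _ theta_hom).
split; apply/umod_hom_eq/funext => x /=; last exact: thetaK.
by apply: theta_inj; rewrite thetaK.
Qed.

End Induction.

Lemma corner_morita : morita_equivalent R A.
Proof.
apply: (@equivalence_criterion _ _ cut_functor).
- exact: cut_functor_faithful.
- exact: cut_functor_full.
- exact: cut_functor_ess.
Qed.

End CornerMorita.

(** * Corners of Leavitt path algebras *)

Section CornerRing.
Variables (K : fieldType) (E : graph) (V : set (vertex E)).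

Local Notation L := (leavitt K E).
Local Notation lv := (lvertex K (E := E)).

Definition corner_pred : {pred L} := fun x => `[< corner K V x >].

Lemma corner_predP x : reflect (corner K V x) (x \in corner_pred).
Proof. exact: asboolP. Qed.

Lemma corner_common_supp x y : corner K V x -> corner K V y ->
  exists s, [/\ supp s x, supp s y & forall v, v \in s -> V v].
Proof.
move=> /cornerP[s [sx sV]] /cornerP[t [ty tV]].
have [sx' sy'] := supp_undup sx ty; exists (undup (s ++ t)); split=> // v.
by rewrite mem_undup mem_cat => /orP[/sV|/tV].
Qed.

Lemma corner_mulmul x y z : corner K V x -> corner K V y ->
  corner K V (x ** z ** y).
Proof.
move=> xV yV; have [s [sx sy sV]] := corner_common_supp xV yV.
by apply/cornerP; exists s; split=> //; apply: suppM.
Qed.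

Lemma corner_units x y : corner K V x -> corner K V y ->
  exists2 u, corner K V u & [/\ u ** x = x, x ** u = x, u ** y = y & y ** u = y].
Proof.
move=> xV yV; have [s [[sU sx xs] [_ sy ys] sV]] := corner_common_supp xV yV.
exists (usum K s); last by split.
by apply/cornerP; exists s; split=> //; apply: usum_id.
Qed.

Fact corner_closed : zmod_closed corner_pred.
Proof.
split.
  by apply/corner_predP/cornerP; exists [::]; split=> //; apply: supp0.
move=> x y /corner_predP xV /corner_predP yV; apply/corner_predP/cornerP.
have [s [sx sy sV]] := corner_common_supp xV yV; exists s; split=> //.
by rewrite -scaleN1r; apply: suppD => //; apply: suppZ.
Qed.

HB.instance Definition _ := GRing.isZmodClosed.Build L corner_pred corner_closed.

Definition corner_ring : Type := {x : L | x \in corner_pred}.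
HB.instance Definition _ := SubType.on corner_ring.
HB.instance Definition _ := Choice.on corner_ring.
HB.instance Definition _ := [SubChoice_isSubZmodule of corner_ring by <:].

Lemma corner_ringP (x : corner_ring) : corner K V (val x).
Proof. exact/corner_predP/(valP x). Qed.

Definition in_corner x (xV : corner K V x) : corner_ring :=
  exist (fun y => y \in corner_pred) x (introT (corner_predP x) xV).

Fact corner_mul_subproof (x y : corner_ring) : corner K V (val x ** val y).
Proof.
have [u _ [_ xu _ _]] := corner_units (corner_ringP x) (corner_ringP x).
by rewrite -xu; apply: corner_mulmul; apply: corner_ringP.
Qed.

Definition corner_mul x y : corner_ring := in_corner (corner_mul_subproof x y).

Fact corner_mulA : associative corner_mul.
Proof. by move=> x y z; apply: val_inj; rewrite /= mulgA. Qed.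

HB.instance Definition _ := isSemigroup.Build corner_ring corner_mulA.

Fact corner_mulDl (x y z : corner_ring) : (x + y) ** z = x ** z + y ** z.
Proof. by apply: val_inj; rewrite /= numulDl. Qed.
Fact corner_mulDr (x y z : corner_ring) : x ** (y + z) = x ** y + x ** z.
Proof. by apply: val_inj; rewrite /= numulDr. Qed.

HB.instance Definition _ :=
  isNonunitalRing.Build corner_ring corner_mulDl corner_mulDr.

Lemma corner_local_units : local_units corner_ring.
Proof.
move=> x y; have [u uV [ux xu uy yu]] :=
  corner_units (corner_ringP x) (corner_ringP y).
by exists (in_corner uV); split; apply: val_inj.
Qed.

End CornerRing.

Lemma leavitt_local_units (K : fieldType) (E : graph) : local_units (leavitt K E).
Proof.
move=> x y; have [s sx] := supp_exists x; have [t ty] := supp_exists y.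
have [[_ ux xu] [_ uy yu]] := supp_undup sx ty.
by exists (usum K (undup (s ++ t))).
Qed.

Lemma lvertex_corner (K : fieldType) (E : graph) (V : set (vertex E)) v :
  V v -> corner K V (lvertex K v).
Proof.
move=> Vv; apply/cornerP; exists [:: v]; split; last by move=> u; rewrite inE => /eqP->.
by have := @usum_id K E [:: v] isT; rewrite /usum big_seq1.
Qed.

Lemma full_corner_morita (K : fieldType) (E : graph) (V : set (vertex E))
    (A : nuRingType) (i : A -> leavitt K E) :
    full_corner V -> {morph i : x y / x + y} -> {morph i : x y / x ** y} ->
    injective i -> (forall x, corner K V x <-> exists a, i a = x) ->
    local_units A ->
  morita_equivalent (leavitt K E) A.
Proof.
move=> Vfull iD iM i_inj iV A_units; apply: corner_morita => //.
- move=> a r b; have [c <-] : exists c, i c = i a ** r ** i b; last by exists c.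
  by apply/iV/corner_mulmul; apply/iV; [exists a | exists b].
- exact: leavitt_local_units.
- move=> x; have [s [sV ->]] := full_corner_ideal (K := K) Vfull x.
  exists [seq (t.1.1, lvertex K t.1.2, t.2) | t <- s]; split.
    by move=> _ /mapP[t ts ->]; apply/iV/lvertex_corner/sV.
  by rewrite big_map.
Qed.

(** * Full corners along a sequence of moves *)

Definition corner_related (K : fieldType) (E F : graph) : Prop :=
  exists (V : set (vertex E)) (W : set (vertex F)),
    [/\ full_corner V, full_corner W & subalg_iso (corner K V) (corner K W)].

Lemma subalg_iso_sym (K : fieldType) (E F : graph) V W :
  subalg_iso (@corner K E V) (@corner K F W) ->
  subalg_iso (@corner K F W) (@corner K E V).
Proof.
move=> [f [[fVW finj fsurj] fD fM fZ]].
have [g gP] : exists g : leavitt K F -> leavitt K E, forall y, corner K W y ->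
    corner K V (g y) /\ f (g y) = y.
  suff /choice[g gP] : forall y : leavitt K F, exists x : leavitt K E,
      corner K W y -> corner K V x /\ f x = y by exists g.
  move=> y; case: (pselect (corner K W y)) => [Wy|nWy]; last by exists 0.
  by have [x Vx <-] := fsurj _ Wy; exists x.
have gV y : corner K W y -> corner K V (g y) by move=> /gP[].
have fg y : corner K W y -> f (g y) = y by move=> /gP[].
have gf x : corner K V x -> g (f x) = x.
  move=> Vx; have fx := fVW _ Vx.
  by apply: finj; rewrite ?inE; [apply: gV | | apply: fg].
have ringV x y (k : K) : corner K V x -> corner K V y ->
    [/\ corner K V (x + y), corner K V (x ** y) & corner K V (k *: x)].
  move=> Vx Vy; have [s [sx sy sV]] := corner_common_supp Vx Vy; split.
  - by apply/cornerP; exists s; split=> //; apply: suppD.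
  - have [_ _ <-] := sx; apply: corner_mulmul => //.
  - by apply/cornerP; exists s; split=> //; apply: suppZ.
exists g; split; [split | | |].
- exact: gV.
- by move=> x y /[!inE] Wx Wy gxy; rewrite -(fg _ Wx) gxy fg.
- by move=> x Vx; exists (f x); [apply: fVW | apply: gf].
- move=> x y Wx Wy; rewrite -{1}(fg _ Wx) -{1}(fg _ Wy) -fD ?gf //; try exact: gV.
  by have [] := ringV _ _ 0 (gV _ Wx) (gV _ Wy).
- move=> x y Wx Wy; rewrite -{1}(fg _ Wx) -{1}(fg _ Wy) -fM ?gf //; try exact: gV.
  by have [] := ringV _ _ 0 (gV _ Wx) (gV _ Wy).
- move=> k x Wx; rewrite -{1}(fg _ Wx) -fZ ?gf //; try exact: gV.
  by have [] := ringV _ _ k (gV _ Wx) (gV _ Wx).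
Qed.

Lemma corner_related_sym K E F : corner_related K E F -> corner_related K F E.
Proof.
move=> [V [W [Vf Wf VW]]]; exists W, V; split=> //.
exact: subalg_iso_sym.
Qed.

Lemma collapse_related K E T F j mu :
  @is_collapse E T F j mu -> corner_related K F E.
Proof.
move=> col; exists [set: vertex F], [set v | ~~ T v]; split.
- exact: setT_full.
- exact: collapse_full col.
- exact: collapse_corner_iso col.
Qed.

Lemma graph_iso_related K E F : graph_iso E F -> corner_related K E F.
Proof. by move=> /graph_iso_collapse[j [mu col]]; apply: collapse_related col. Qed.

(** The ring of the first corner is also a corner of the second algebra, through
the given isomorphism. *)
Lemma corner_related_morita K E F :
  corner_related K E F -> morita_equivalent (leavitt K E) (leavitt K F).
Proof.
move=> [V [W [Vfull Wfull [f [[fVW finj fsurj] fD fM fZ]]]]].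
have f_inj : injective (f \o val : corner_ring K V -> leavitt K F).
  move=> x y /= fxy; apply/val_inj/finj; rewrite ?inE //; exact: corner_ringP.
apply: (@equivalent_categories_trans _ (umod_category (corner_ring K V))).
  apply: (@full_corner_morita K E V (corner_ring K V) (fun x => val x)).
  - exact: Vfull.
  - by move=> x y.
  - by move=> x y.
  - by move=> x y; apply: val_inj.
  - move=> x; split=> [xV|[a <-]]; last exact: corner_ringP.
    by exists (in_corner xV).
  - exact: corner_local_units.
apply/equivalent_categories_sym.
apply: (@full_corner_morita K F W (corner_ring K V) (fun x => f (val x))) => //.
- by move=> x y; apply: fD; apply: corner_ringP.
- by move=> x y; apply: fM; apply: corner_ringP.
- move=> y; split=> [/fsurj[x xV <-]|[a <-]]; first by exists (in_corner xV).
  by apply: fVW; apply: corner_ringP.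
- exact: corner_local_units.
Qed.

Inductive corner_chain (K : fieldType) : graph -> graph -> Prop :=
| ChainNil E : corner_chain K E E
| ChainCons E F H of corner_related K E F & corner_chain K F H : corner_chain K E H.

Lemma corner_chain1 K E F : corner_related K E F -> corner_chain K E F.
Proof. by move=> EF; apply: ChainCons EF (ChainNil K F). Qed.

Lemma corner_chain_trans K E F H :
  corner_chain K E F -> corner_chain K F H -> corner_chain K E H.
Proof. by elim=> // {}E {}F I EF _ IH FH; apply: ChainCons EF (IH FH). Qed.

Lemma corner_chain_sym K E F : corner_chain K E F -> corner_chain K F E.
Proof.
elim=> [{}E|{}E {}F I EF _ IF]; first exact: ChainNil.
exact: corner_chain_trans IF (corner_chain1 (corner_related_sym EF)).
Qed.

Lemma move_chain K E F : move E F -> corner_chain K E F.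
Proof.
have collapse_chain E' T F' j mu : @is_collapse E' T F' j mu -> corner_chain K E' F'.
  by move=> col; apply/corner_chain1/corner_related_sym/(collapse_related K col).
case=> [w ws wreg|w n c wns cb ci|w n c wreg _ _|w x f wi wo fr wreg] iso;
  apply: corner_chain_trans (corner_chain1 (graph_iso_related K iso)).
- exact: collapse_chain (moveS_collapse ws wreg).
- apply: corner_chain1; exists [set: vertex E], [set: vertex (moveO w c)].
  by split; [exact: setT_full | exact: setT_full | exact: moveO_iso].
(* the graph with the subdivided edges collapses both to [E] and to [moveI] *)
- apply: corner_chain_trans (collapse_chain _ _ _ _ _ (moveI_collapse c wreg)).
  exact/corner_chain_sym/(collapse_chain _ _ _ _ _ (in_delay_collapse w c)).
- exact: collapse_chain (moveR_collapse wi wo fr wreg).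
Qed.

Lemma move_equivalent_chain K E F : move_equivalent E F -> corner_chain K E F.
Proof.
move=> [n [G [E0 nF Gmove]]].
apply: corner_chain_trans (corner_chain1 (graph_iso_related K E0)) _.
apply: corner_chain_trans _ (corner_chain1 (graph_iso_related K nF)).
elim: n {nF} Gmove => [|n IHn] Gmove; first exact: ChainNil.
apply: (corner_chain_trans (F := G n)).
  by apply: IHn => i ilt; apply: Gmove; apply: ltnW.
have [|] := Gmove n (ltnSn n); first exact: move_chain.
by move/(move_chain K)/corner_chain_sym.
Qed.

Lemma corner_chain_morita K E F :
  corner_chain K E F -> morita_equivalent (leavitt K E) (leavitt K F).
Proof.
elim=> [{}E|{}E {}F H EF _]; first exact: equivalent_categories_refl.
exact/equivalent_categories_trans/corner_related_morita.
Qed.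

Lemma corner_chain_seq K E F : corner_chain K E F ->
  exists (n : nat) (G : nat -> graph), G 0%N = E /\ G n = F /\
    forall i, (i < n)%N -> corner_related K (G i) (G i.+1).
Proof.
elim=> [{}E|{}E {}F H EF _ [n [G [GF [GH Grel]]]]].
  by exists 0%N, (fun=> E).
exists n.+1, (fun i => if i is k.+1 then G k else E); split=> //; split=> //.
by case=> [_|i /Grel//]; rewrite GF.
Qed.

Local Close Scope ring_scope.
Local Close Scope classical_set_scope.

Theorem theorem3p11 (E F : graph) (E_sim_F : move_equivalent E F)
    (K : fieldType) :
  morita_equivalent (leavitt K E) (leavitt K F) /\
  exists (n : nat) (G : nat -> graph),
    G 0 = E /\ G n = F /\
    exists (V : forall i : nat, set (vertex (G i)))
           (W : forall i : nat, set (vertex (G i.+1))),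
      forall i : nat, (i < n)%N ->
        [/\ full_corner (V i),
            full_corner (W i)
          & subalg_iso (corner K (V i)) (corner K (W i))].
Proof.
have chain := move_equivalent_chain K E_sim_F.
split; first exact: corner_chain_morita.
have [n [G [G0 [Gn Grel]]]] := corner_chain_seq chain.
exists n, G; split=> //; split=> //.
have choose i : exists VW : set (vertex (G i)) * set (vertex (G i.+1)),
    (i < n)%N -> [/\ full_corner VW.1, full_corner VW.2
      & subalg_iso (corner K VW.1) (corner K VW.2)].
  case: (ltnP i n) => [/Grel[V [W VW]]|_]; first by exists (V, W).
  by exists (set0, set0).
exists (fun i => (projT1 (cid (choose i))).1).
exists (fun i => (projT1 (cid (choose i))).2).
by move=> i; apply: (projT2 (cid (choose i))).
Qed.
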